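(* Let $\mathbb{T}\cong(\mathbb{C}^* )^d$ be an algebraic torus and let $\pi:Y\to X$ be a surjective $\mathbb{T}$-equivariant projective morphism from a connected, non-compact, non-singular complex variety $Y$ with $\mathbb{T}$-action to an affine variety $X$ with $\mathbb{T}$-action. Then $N_+(Y)=N_+(X)$ and $N_0(Y)=N_0(X)$; denote these by $N_+$ and $N_0$. More explicitly, let $f_{w^1},\ldots,f_{w^m}$ be non-constant $\mathbb{T}$-homogeneous generators of the coordinate ring $\mathbb{C}[X]=\bigoplus_{w\in M}\mathbb{C}[X]_w$ as a unital $\mathbb{C}$-algebra, with $f_{w^j}\in\mathbb{C}[X]_{w^j}$ (the $w^j\in M$ need not be distinct). Then $$N_0=\{v\in N:\langle v,w^j\rangle\ge 0\text{ for }j=1,\ldots,m\},\qquad N_+=\{v\in N:\langle v,w^j\rangle>0\text{ for }j=1,\ldots,m\}.$$ Moreover, if $N_+\ne\emptyset$, then $\mathbb{C}[X]_0=\mathbb{C}$ (the constants), so all $w^j\ne 0$, and for every $v\in N_+$ the action $\varphi_v$ contracts $X$ to the unique $\mathbb{T}$-fixed point of $X$.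
   Context: $N:=\mathrm{Hom}(\mathbb{C}^*,\mathbb{T})\cong\mathbb{Z}^d$ is the lattice of one-parameter subgroups, $M:=\mathrm{Hom}(\mathbb{T},\mathbb{C}^* )\cong\mathbb{Z}^d$ the lattice of characters, and $\langle\cdot,\cdot\rangle:N\times M\to\mathrm{Hom}(\mathbb{C}^*,\mathbb{C}^* )\cong\mathbb{Z}$ the pairing given by composition. For $v\in N$, $\varphi_v$ denotes the induced $\mathbb{C}^*$-action, both on $Y$ and on $X$. The ring $\mathbb{C}[X]$ is $M$-graded, with $\mathbb{C}[X]_w$ the functions of weight $w$, so $(\varphi_v(t))^*f=t^{\langle v,w\rangle}f$ for $f\in\mathbb{C}[X]_w$, $t\in\mathbb{C}^*$. All topological notions refer to the Euclidean (analytic) topology. A $\mathbb{C}^*$-action $\psi$ on a space $Z$ is complete if $\lim_{\mathbb{C}^*\ni t\to0}\psi_t(z)$ exists in $Z$ for all $z\in Z$; it is contracting if it is complete and its fixed locus is compact. $N_0(Z)=\{v\in N:\varphi_v\text{ is complete on }Z\}$ and $N_+(Z)=\{v\in N:\varphi_v\text{ is contracting on }Z\}$, for $Z=X,Y$. An action contracts $X$ to a point $x_0$ if $\lim_{t\to 0}$ of every point is $x_0$. *)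

(* Defs.v *)
From HB Require Import structures.
From mathcomp Require Import all_boot all_order all_algebra.
From mathcomp Require Import all_classical all_reals all_analysis.
From mathcomp Require Import complex.
From mathcomp Require mpoly.

Set Implicit Arguments.
Unset Strict Implicit.
Unset Printing Implicit Defensive.

Import Order.TTheory GRing.Theory Num.Theory.
Import numFieldNormedType.Exports.

Local Open Scope classical_set_scope.
Local Open Scope ring_scope.

(* The name (rather than [R[i]]) gives the complex numbers the norm topology
   which MathComp-Analysis puts on every numClosedFieldType. *)
Definition Cplx (R : realType) : numClosedFieldType := R[i].

(** * Spaces with functions

   Varieties are treated as in Kempf, "Algebraic Varieties", or Springer,
   "Linear Algebraic Groups": a set of closed points with its Zariski topology
   and its sheaf of C-valued regular functions.  A section over [U] is
   represented by any total function extending it. *)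

Record fspace_on (R : realType) (T : choiceType) := FSpaceOn {
  so_open : set (set T);
  so_regular : set T -> set (T -> Cplx R);
  so_openT : so_open setT;
  so_openI : forall U V, so_open U -> so_open V -> so_open (U `&` V);
  so_open_bigcup : forall F : set (set T),
    F `<=` so_open -> so_open (\bigcup_(U in F) U);
  so_regular_ext : forall U f g, so_open U ->
    (forall x, U x -> f x = g x) -> so_regular U f -> so_regular U g;
  so_regular_restr : forall U V f, so_open U -> so_open V ->
    V `<=` U -> so_regular U f -> so_regular V f;
  so_regular_glue : forall (F : set (set T)) f, F `<=` so_open ->
    (forall U, F U -> so_regular U f) -> so_regular (\bigcup_(U in F) U) f;
  so_regular_cst : forall U c, so_open U -> so_regular U (fun=> c);
  so_regularD : forall U f g, so_open U ->
    so_regular U f -> so_regular U g -> so_regular U (fun x => f x + g x);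
  so_regularM : forall U f g, so_open U ->
    so_regular U f -> so_regular U g -> so_regular U (fun x => f x * g x);
  so_openD : forall U f, so_open U -> so_regular U f ->
    so_open (U `&` [set x | f x != 0]);
  so_regularV : forall U f, so_open U -> so_regular U f ->
    so_regular (U `&` [set x | f x != 0]) (fun x => (f x)^-1)
}.

Record fspace (R : realType) := FSpace {
  pt :> choiceType;
  str : fspace_on R pt
}.

Definition zopen (R : realType) (X : fspace R) : set (set X) :=
  so_open (str X).
Definition zclosed (R : realType) (X : fspace R) : set (set X) :=
  [set A | zopen (~` A)].
Definition regular_on (R : realType) (X : fspace R) (U : set X) :
    set (X -> Cplx R) :=
  so_regular (str X) U.

Definition fmorphism (R : realType) (X Y : fspace R) (phi : X -> Y) : Prop :=
  forall V : set Y, zopen V -> zopen (phi @^-1` V) /\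
    forall g, regular_on V g -> regular_on (phi @^-1` V) (g \o phi).

Definition fisomorphism (R : realType) (X Y : fspace R) (phi : X -> Y) : Prop :=
  fmorphism phi /\
  exists psi : Y -> X, [/\ fmorphism psi, cancel phi psi & cancel psi phi].

(** ** Initial and final structures *)

Section InitialSpace.
Variables (R : realType) (T : choiceType).

(* [S D f] : the function [f] is declared regular on the set [D]. *)
Variable S : set T -> set (T -> Cplx R).

Inductive generated : set T -> (T -> Cplx R) -> Prop :=
| Gen_base D f : S D f -> generated D f
| Gen_cst c : generated setT (fun=> c)
| Gen_add D D' f g : generated D f -> generated D' g ->
    generated (D `&` D') (fun x => f x + g x)
| Gen_mul D D' f g : generated D f -> generated D' g ->
    generated (D `&` D') (fun x => f x * g x).

Definition init_open : set (set T) := [set U | forall x, U x ->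
  exists D g, [/\ generated D g, D x, g x != 0 &
    forall y, D y -> g y != 0 -> U y]].

Definition init_regular (U : set T) : set (T -> Cplx R) :=
  [set f | forall x, U x -> exists D g h,
    [/\ generated D g, generated D h, D x, h x != 0 &
      forall y, U y -> D y -> h y != 0 -> f y = g y / h y]].

Let gen_cstD D f c : generated D f -> generated D (fun=> c).
Proof.
move=> Df; have := Gen_add (Gen_mul Df (Gen_cst 0)) (Gen_cst c).
rewrite !setIT; set k := (fun _ => _); suff -> : k = (fun=> c) by [].
by apply/funext => x; rewrite /k mulr0 add0r.
Qed.

Let gen_mulI D f g : generated D f -> generated D g ->
  generated D (fun x => f x * g x).
Proof. by move=> Df Dg; rewrite -[D]setIid; exact: Gen_mul. Qed.

Let gen_addI D f g : generated D f -> generated D g ->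
  generated D (fun x => f x + g x).
Proof. by move=> Df Dg; rewrite -[D]setIid; exact: Gen_add. Qed.

Let gen_restrl D D' f g : generated D f -> generated D' g ->
  generated (D `&` D') f.
Proof.
move=> Df Dg; have := Gen_mul Df (gen_cstD 1 Dg).
by under eq_fun do rewrite mulr1.
Qed.

Let gen_restrr D D' f g : generated D f -> generated D' g ->
  generated (D `&` D') g.
Proof. by move=> Df Dg; rewrite setIC; apply: gen_restrl Df. Qed.

Let openT : init_open setT.
Proof.
by move=> x _; exists setT, (fun=> 1); split => //; exact: Gen_cst.
Qed.

Let openI U V : init_open U -> init_open V -> init_open (U `&` V).
Proof.
move=> oU oV x [/oU[D [g [Dg Dx gx sU]]] /oV[D' [g' [Dg' Dx' gx' sV]]]].
exists (D `&` D'), (fun x => g x * g' x); split.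
- exact: Gen_mul.
- by [].
- by rewrite mulf_neq0.
- move=> y [Dy Dy']; rewrite mulf_eq0 negb_or => /andP[gy gy'].
  by split; [exact: sU | exact: sV].
Qed.

Let open_bigcup (F : set (set T)) :
  F `<=` init_open -> init_open (\bigcup_(U in F) U).
Proof.
move=> oF x [U FU Ux]; have [D [g [Dg Dx gx sU]]] := oF _ FU _ Ux.
by exists D, g; split => // y Dy gy; exists U => //; exact: sU.
Qed.

Let regular_ext U f g : init_open U ->
  (forall x, U x -> f x = g x) -> init_regular U f -> init_regular U g.
Proof.
move=> _ fg rf x /rf[D [a [b [Da Db Dx bx e]]]].
by exists D, a, b; split => // y Uy Dy byn; rewrite -fg // e.
Qed.

Let regular_restr U V f : init_open U -> init_open V ->
  V `<=` U -> init_regular U f -> init_regular V f.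
Proof.
move=> _ _ VU rf x /VU/rf[D [a [b [Da Db Dx bx e]]]].
by exists D, a, b; split => // y /VU; exact: e.
Qed.

Let regular_glue (F : set (set T)) f : F `<=` init_open ->
  (forall U, F U -> init_regular U f) -> init_regular (\bigcup_(U in F) U) f.
Proof.
move=> oF rF x [U FU Ux]; have [D [a [b [Da Db Dx bx e]]]] := rF _ FU _ Ux.
have [D' [k [Dk Dx' kx sU]]] := oF _ FU _ Ux.
exists (D `&` D'), (fun x => a x * k x), (fun x => b x * k x); split.
- exact: Gen_mul.
- exact: Gen_mul.
- by [].
- by rewrite mulf_neq0.
- move=> y _ [Dy Dy']; rewrite mulf_eq0 negb_or => /andP[byn ky].
  by rewrite e //; [rewrite -mulf_div divff // mulr1 | exact: sU].
Qed.

Let regular_cst U c : init_open U -> init_regular U (fun=> c).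
Proof.
move=> _ x _; exists setT, (fun=> c), (fun=> 1); split => //.
- exact: Gen_cst.
- exact: Gen_cst.
- by move=> y _ _ _; rewrite divr1.
Qed.

Let regularD U f g : init_open U ->
  init_regular U f -> init_regular U g -> init_regular U (fun x => f x + g x).
Proof.
move=> _ rf rg x Ux; have [D [a [b [Da Db Dx bx e]]]] := rf x Ux.
have [D' [a' [b' [Da' Db' Dx' bx' e']]]] := rg x Ux.
exists (D `&` D'), (fun x => a x * b' x + a' x * b x), (fun x => b x * b' x).
split.
- apply: gen_addI; apply: gen_mulI.
  + exact: gen_restrl Da Da'.
  + exact: gen_restrr Db Db'.
  + exact: gen_restrr Da Da'.
  + exact: gen_restrl Db Db'.
- exact: Gen_mul.
- by [].
- by rewrite mulf_neq0.
- move=> y Uy [Dy Dy']; rewrite mulf_eq0 negb_or => /andP[byn byn'].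
  by rewrite e // e' // addf_div.
Qed.

Let regularM U f g : init_open U ->
  init_regular U f -> init_regular U g -> init_regular U (fun x => f x * g x).
Proof.
move=> _ rf rg x Ux; have [D [a [b [Da Db Dx bx e]]]] := rf x Ux.
have [D' [a' [b' [Da' Db' Dx' bx' e']]]] := rg x Ux.
exists (D `&` D'), (fun x => a x * a' x), (fun x => b x * b' x); split.
- exact: Gen_mul.
- exact: Gen_mul.
- by [].
- by rewrite mulf_neq0.
- move=> y Uy [Dy Dy']; rewrite mulf_eq0 negb_or => /andP[byn byn'].
  by rewrite e // e' // mulf_div.
Qed.

Let openD U f : init_open U -> init_regular U f ->
  init_open (U `&` [set x | f x != 0]).
Proof.
move=> oU rf x [Ux fx]; have [D [a [b [Da Db Dx bx e]]]] := rf x Ux.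
have [D' [k [Dk Dx' kx sU]]] := oU x Ux.
exists (D `&` D'), (fun x => (a x * b x) * k x); split.
- by apply: Gen_mul => //; exact: gen_mulI.
- by [].
- rewrite !mulf_neq0 //; apply: contra_neq fx => a0.
  by rewrite e // a0 mul0r.
- move=> y [Dy Dy']; rewrite !mulf_eq0 !negb_or => /andP[/andP[ay byn] ky].
  have Uy : U y by exact: sU.
  by split => //=; rewrite e // mulf_neq0 // invr_eq0.
Qed.

Let regularV U f : init_open U -> init_regular U f ->
  init_regular (U `&` [set x | f x != 0]) (fun x => (f x)^-1).
Proof.
move=> oU rf x [Ux fx]; have [D [a [b [Da Db Dx bx e]]]] := rf x Ux.
exists D, (fun x => b x * b x), (fun x => a x * b x); split.
- exact: gen_mulI.
- exact: gen_mulI.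
- by [].
- rewrite mulf_neq0 //; apply: contra_neq fx => a0.
  by rewrite e // a0 mul0r.
- move=> y [Uy fy] Dy; rewrite mulf_eq0 negb_or => /andP[ay byn].
  by rewrite e // invf_div -mulf_div divff // mulr1.
Qed.

(* The coarsest structure on [T] for which each [f] with [S D f] is a regular
   function on the open set [D]. *)
Definition initial_on : fspace_on R T :=
  FSpaceOn openT openI open_bigcup regular_ext regular_restr regular_glue
    regular_cst regularD regularM openD regularV.

End InitialSpace.

Section FinalSpace.
Variables (R : realType) (Z : fspace R) (T : choiceType) (q : Z -> T).

Definition fin_open : set (set T) := [set U | zopen (q @^-1` U)].
Definition fin_regular (U : set T) : set (T -> Cplx R) :=
  [set f : T -> Cplx R | regular_on (q @^-1` U) (f \o q)].

Let fopen_bigcup (F : set (set T)) :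
  F `<=` fin_open -> fin_open (\bigcup_(U in F) U).
Proof.
move=> oF; rewrite /fin_open /= preimage_bigcup.
rewrite -(bigcup_image F (preimage q) id); apply: so_open_bigcup.
by move=> _ [U FU <-]; exact: oF.
Qed.

Let fregular_glue (F : set (set T)) f : F `<=` fin_open ->
  (forall U, F U -> fin_regular U f) -> fin_regular (\bigcup_(U in F) U) f.
Proof.
move=> oF rF; rewrite /fin_regular /= preimage_bigcup.
rewrite -(bigcup_image F (preimage q) id); apply: so_regular_glue.
  by move=> _ [U FU <-]; exact: oF.
by move=> _ [U FU <-]; exact: rF.
Qed.

Let fregular_ext U f g : fin_open U ->
  (forall x, U x -> f x = g x) -> fin_regular U f -> fin_regular U g.
Proof. by move=> oU fg; apply: so_regular_ext => // x; exact: fg. Qed.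

Let fregular_restr U V f : fin_open U -> fin_open V ->
  V `<=` U -> fin_regular U f -> fin_regular V f.
Proof. by move=> oU oV VU; apply: so_regular_restr => // x; exact: VU. Qed.

(* The quotient structure along [q]. *)
Definition final_on : fspace_on R T :=
  @FSpaceOn R T fin_open fin_regular
    (so_openT (str Z))
    (fun U V => @so_openI _ _ (str Z) (q @^-1` U) (q @^-1` V))
    fopen_bigcup fregular_ext fregular_restr fregular_glue
    (fun U c => @so_regular_cst _ _ (str Z) (q @^-1` U) c)
    (fun U f g => @so_regularD _ _ (str Z) (q @^-1` U) (f \o q) (g \o q))
    (fun U f g => @so_regularM _ _ (str Z) (q @^-1` U) (f \o q) (g \o q))
    (fun U f => @so_openD _ _ (str Z) (q @^-1` U) (f \o q))
    (fun U f => @so_regularV _ _ (str Z) (q @^-1` U) (f \o q)).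

End FinalSpace.

Definition induced (R : realType) (Z : fspace R) (T : choiceType)
    (i : T -> Z) : fspace R :=
  FSpace (initial_on (fun D f => exists W g,
    [/\ zopen W, regular_on W g, D = i @^-1` W & f = g \o i])).

Definition subspace (R : realType) (Z : fspace R) (A : set Z) : fspace R :=
  induced (fun x : set_type A => \val x).

Definition prod_space (R : realType) (X Y : fspace R) : fspace R :=
  FSpace (initial_on (fun (D : set (X * Y)) f =>
    (exists U g,
      [/\ zopen U, regular_on U g, D = fst @^-1` U & f = g \o fst]) \/
    (exists V g,
      [/\ zopen V, regular_on V g, D = snd @^-1` V & f = g \o snd]))).

(** ** Affine and projective space *)

(* Generated by the coordinates: opens are unions of sets [p <> 0] and regular
   functions are locally quotients [p / q], with [p], [q] polynomials. *)
Definition affine_space (R : realType) (n : nat) : fspace R :=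
  FSpace (initial_on (fun (D : set 'rV[Cplx R]_n) f =>
    D = setT /\ exists i, f = fun x => x ord0 i)).

(* Points are the lines of C^(n+1). *)
Definition proj_pt (R : realType) (n : nat) : choiceType :=
  {L : {vspace 'rV[Cplx R]_n.+1} | \dim L == 1}.

Definition punctured_space (R : realType) (n : nat) : fspace R :=
  @induced R (affine_space R n) {v : 'rV[Cplx R]_n | v != 0} sval.

Fact line_subproof (R : realType) (n : nat) (v : punctured_space R n.+1) :
  \dim <[sval v : 'rV[Cplx R]_n.+1]>%VS == 1.
Proof. by rewrite dim_vline (svalP v). Qed.

Definition line (R : realType) (n : nat) (v : punctured_space R n.+1) :
    proj_pt R n :=
  exist (fun L : {vspace 'rV[Cplx R]_n.+1} => is_true (\dim L == 1)) _
    (line_subproof v).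

Definition proj_space (R : realType) (n : nat) : fspace R :=
  FSpace (final_on (@line R n)).

(** ** Varieties *)

Definition closed_immersion (R : realType) (Y Z : fspace R) (i : Y -> Z) :
    Prop :=
  [/\ injective i, zclosed (range i),
      forall U : set Y, zopen U <-> @zopen R (induced i) U &
      forall (U : set Y) f, zopen U ->
        (regular_on U f <-> @regular_on R (induced i) U f)].

Definition affine_variety (R : realType) (X : fspace R) : Prop :=
  exists n (i : X -> affine_space R n), closed_immersion i.

Definition separated (R : realType) (X : fspace R) : Prop :=
  @zclosed R (prod_space X X) [set p | p.1 = p.2].

Definition variety (R : realType) (X : fspace R) : Prop :=
  separated X /\
  exists n (U : 'I_n -> set X), \bigcup_i U i = setT /\
    forall i, zopen (U i) /\ affine_variety (subspace (U i)).

(* As [X] is affine in all uses, this is also projectivity in the sense of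
   EGA. *)
Definition projective_morphism (R : realType) (Y X : fspace R) (p : Y -> X) :
    Prop :=
  exists n (i : Y -> prod_space X (proj_space R n)),
    closed_immersion i /\ forall y, (i y).1 = p y.

(** ** Non-singularity *)

Definition irreducible_closed (R : realType) (X : fspace R) (A : set X) :
    Prop :=
  [/\ zclosed A, A !=set0 &
    forall B B' : set X, zclosed B -> zclosed B' ->
      A `<=` B `|` B' -> A `<=` B \/ A `<=` B'].

Definition has_chain_at (R : realType) (X : fspace R) (x : X) (k : nat) :
    Prop :=
  exists A : nat -> set X,
    (forall i, (i <= k)%N -> irreducible_closed (A i) /\ A i x) /\
    (forall i, (i < k)%N -> A i `<` A i.+1).

(* The Krull dimension of the local ring at [x], whose primes correspond to
   the irreducible closed sets through [x]. *)
Definition dim_at (R : realType) (X : fspace R) (x : X) (k : nat) : Prop :=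
  has_chain_at x k /\ ~ has_chain_at x k.+1.

(* The maximal ideal of the local ring at [x] is generated by [k] germs. *)
Definition max_ideal_generated_by (R : realType) (X : fspace R) (x : X)
    (k : nat) : Prop :=
  exists (U : set X) (g : 'I_k -> X -> Cplx R),
    [/\ zopen U, U x, forall j, regular_on U (g j) /\ g j x = 0 &
      forall V f, zopen V -> V x -> regular_on V f -> f x = 0 ->
        exists (W : set X) (c : 'I_k -> X -> Cplx R),
          [/\ zopen W, W x, W `<=` U `&` V, forall j, regular_on W (c j) &
            forall y, W y -> f y = \sum_j c j y * g j y]].

(* All local rings are regular. *)
Definition nonsingular (R : realType) (X : fspace R) : Prop :=
  forall x : X, exists2 k, dim_at x k & max_ideal_generated_by x k.

(** * The Euclidean topology *)

Definition euclidean (R : realType) (X : fspace R) : Type := X.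

Section Euclidean.
Variables (R : realType) (X : fspace R).

Definition euclidean_subbase : set (set (euclidean X)) :=
  [set A | exists (U : set X) (f : X -> Cplx R) (O : set (Cplx R)),
    [/\ zopen U, regular_on U f, open O & A = U `&` f @^-1` O]].

HB.instance Definition _ := Choice.on (euclidean X).
(* The coarsest topology in which Zariski open sets are open and regular
   functions are continuous. *)
HB.instance Definition _ :=
  isSubBaseTopological.Build (euclidean X) euclidean_subbase id.

End Euclidean.

(** * Tori *)

Definition Gm (R : realType) : Type := {t : Cplx R | t != 0}.

Section MultiplicativeGroup.
Variable R : realType.

HB.instance Definition _ := SubChoice.on (Gm R).

Definition gm_val (t : Gm R) : Cplx R := sval t.

Definition gm_one : Gm R := exist _ 1 (oner_neq0 (Cplx R)).
Definition gm_mul (s t : Gm R) : Gm R :=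
  exist _ (gm_val s * gm_val t) (mulf_neq0 (svalP s) (svalP t)).
Definition gm_inv (t : Gm R) : Gm R :=
  exist _ (gm_val t)^-1 (invr_neq0 (svalP t)).

Let mulgA : associative gm_mul.
Proof. by move=> r s t; apply/val_inj; rewrite /= /gm_val /= mulrA. Qed.
Let mul1g : left_id gm_one gm_mul.
Proof. by move=> t; apply/val_inj; rewrite /= /gm_val /= mul1r. Qed.
Let mulg1 : right_id gm_one gm_mul.
Proof. by move=> t; apply/val_inj; rewrite /= /gm_val /= mulr1. Qed.
Let mulVg : left_inverse gm_one gm_inv gm_mul.
Proof.
by move=> t; apply/val_inj; rewrite /= /gm_val /= mulVf // (svalP t).
Qed.
Let mulgV : right_inverse gm_one gm_inv gm_mul.
Proof.
by move=> t; apply/val_inj; rewrite /= /gm_val /= mulfV // (svalP t).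
Qed.

HB.instance Definition _ :=
  isGroup.Build (Gm R) mulgA mul1g mulg1 mulVg mulgV.

(* The filter "t tends to 0 in Gm". *)
Definition gm_to0 : set_system (Gm R) :=
  [set A | \forall z \near (0 : Cplx R), forall t, gm_val t = z -> A t].

Definition Gm_space : fspace R :=
  @induced R (affine_space R 1) (Gm R) (fun t => const_mx (gm_val t)).

(* The torus Gm^d, with the pointwise group structure of finite functions. *)
Definition std_torus_space (d : nat) : fspace R :=
  @induced R (affine_space R d) {ffun 'I_d -> Gm R}
    (fun t => \row_i gm_val (t i)).

End MultiplicativeGroup.

Record torus (R : realType) (d : nat) := Torus {
  torus_group :> groupType;
  torus_str : fspace_on R torus_group;
  torus_iso : exists2 phi : FSpace torus_str -> std_torus_space R d,
    fisomorphism phi &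
    forall s t : torus_group,
      (phi (s * t)%g : {ffun 'I_d -> Gm R}) =
      ((phi s : {ffun 'I_d -> Gm R}) * (phi t : {ffun 'I_d -> Gm R}))%g
}.

Definition torus_space (R : realType) (d : nat) (T : torus R d) : fspace R :=
  FSpace (torus_str T).

Section Lattices.
Variables (R : realType) (d : nat) (T : torus R d).

(* The lattice N = Hom(Gm, T). *)
Definition cocharacter : set (Gm R -> T) :=
  [set v | @fmorphism R (Gm_space R) (torus_space T) v /\
           forall s t, v (s * t)%g = (v s * v t)%g].

(* The lattice M = Hom(T, Gm). *)
Definition character : set (T -> Gm R) :=
  [set w | @fmorphism R (torus_space T) (Gm_space R) w /\
           forall s t, w (s * t)%g = (w s * w t)%g].

(* The zero of M. *)
Definition trivial_character : T -> Gm R := fun=> 1%g.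

(* [w \o v] is an endomorphism t |-> t ^ k of Gm for a unique integer [k]. *)
Definition pairing (v : Gm R -> T) (w : T -> Gm R) : int :=
  xget 0 [set k : int | forall t, gm_val (w (v t)) = gm_val t ^ k].

End Lattices.

(** * Actions *)

Definition algebraic_action (R : realType) (d : nat) (T : torus R d)
    (Z : fspace R) (a : T -> Z -> Z) : Prop :=
  [/\ forall z, a 1%g z = z,
      forall s t z, a (s * t)%g z = a s (a t z) &
      @fmorphism R (prod_space (torus_space T) Z) Z (fun p => a p.1 p.2)].

(* The Gm-action called phi_v in the literature. *)
Definition act_along (R : realType) (d : nat) (T : torus R d) (Z : fspace R)
    (a : T -> Z -> Z) (v : Gm R -> T) : Gm R -> Z -> Z :=
  fun t z => a (v t) z.

Section CstarActions.
Variables (R : realType) (Z : fspace R) (psi : Gm R -> Z -> Z).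

Definition tends_to (z z0 : Z) : Prop :=
  (fun t => psi t z : euclidean Z) @ @gm_to0 R --> (z0 : euclidean Z).

Definition complete_action : Prop := forall z, exists z0, tends_to z z0.

Definition fixed_locus : set Z := [set z | forall t, psi t z = z].

Definition contracting_action : Prop :=
  complete_action /\ compact (fixed_locus : set (euclidean Z)).

Definition contracts_to (z0 : Z) : Prop := forall z, tends_to z z0.

End CstarActions.

Section TorusActions.
Variables (R : realType) (d : nat) (T : torus R d) (Z : fspace R).
Variable a : T -> Z -> Z.

Definition N_zero : set (Gm R -> T) :=
  [set v | cocharacter v /\ complete_action (act_along a v)].

Definition N_plus : set (Gm R -> T) :=
  [set v | cocharacter v /\ contracting_action (act_along a v)].

Definition torus_fixed : set Z := [set z | forall t, a t z = z].

(* The weight space C[Z]_w. *)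
Definition weight_space (w : T -> Gm R) : set (Z -> Cplx R) :=
  [set f | regular_on setT f /\ forall t z, f (a t z) = gm_val (w t) * f z].

End TorusActions.

(** * Coordinate rings *)

Definition constant_functions (R : realType) (X : fspace R) :
    set (X -> Cplx R) :=
  [set f | exists c, forall x, f x = c].

(* The global regular functions [f j] generate C[X] as a unital C-algebra. *)
Definition generates_coord_ring (R : realType) (X : fspace R) (m : nat)
    (f : 'I_m -> X -> Cplx R) : Prop :=
  (forall j, regular_on setT (f j)) /\
  forall g, regular_on setT g ->
    exists p : mpoly.mpoly m (Cplx R),
      forall x, g x = mpoly.meval (fun j => f j x) p.

(* Main.v *)
Require Import Defs.
From mathcomp Require Import all_boot all_order all_algebra.
From mathcomp Require Import all_classical all_reals all_analysis.
From mathcomp Require Import complex finmap.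
From mathcomp Require mpoly.
Import (canonicals, coercions) mpoly.
From mathcomp Require Import ring.

Set Implicit Arguments.
Unset Strict Implicit.
Unset Printing Implicit Defensive.

Import Order.TTheory GRing.Theory Num.Theory.
Import numFieldNormedType.Exports.
Local Open Scope classical_set_scope.
Local Open Scope ring_scope.

(** Write [phi_v] for the Gm-action given by [v].

    The morphism [p] is continuous and closed immersions have closed images, so
    limits along [phi_v] pass from [Y] to [X]. In the other direction, an orbit
    map from Gm to projective space is given near 0 by polynomials in [t] without
    common zero at 0, hence has a limit there ([proj_space_limit]); as [Y] is
    closed in the product of [X] with a projective space, an orbit in [Y] has a
    limit as soon as its image in [X] has one ([tends_to_lift]). This gives
    [N_zero_eq]. For [N_plus_eq], [p] maps the fixed locus of [Y] onto that of
    [X] ([fixed_locus_image]), and it is proper ([projective_compact]).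

    A multiplicative regular function on Gm is a power of [t]
    ([gm_endomorphism]), so the generator [f j] satisfies
    [f j (phi_v t x) = t ^ k j * f j x], where [k j] is the pairing of [v] with
    the weight of [f j]. Limits in the affine variety [X] can be computed on the
    generators, and [f j] is not zero; so [phi_v] is complete exactly when all
    [k j] are nonnegative ([complete_weights]).

    If all [k j] are positive, every orbit tends to the only point where all
    generators vanish, which is also the only fixed point. The converse is the
    delicate half of [contracting_weights]. If the fixed locus is compact and
    [k j = 0], then [f j] agrees with its restriction to the fixed locus composed
    with the limit map, so [f j] is bounded. A bounded regular function [f] on an
    affine variety has finitely many values ([bounded_regular_root]): for every
    large real [c], the function [1 / (f - c)] is regular because [f - c] has no
    zero; these are uncountably many elements of an algebra of countable
    dimension, and a linear relation between them is a polynomial equation for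
    [f]. As [X], the image of [Y], is connected, [f j] would be constant.

    Finally, if some [phi_v] contracts [X] to [x0], a torus-invariant function
    equals its value at [x0], and [x0] is fixed by the torus because the torus is
    commutative and [x0] is the only point fixed by [phi_v]. *)

(** * Zariski-local criteria and morphisms *)

Section LocalCriteria.
Variables (R : realType) (X : fspace R).

Lemma zopen_bigcup (F : set (set X)) :
  (forall V, F V -> zopen V) -> zopen (\bigcup_(V in F) V).
Proof. by move=> oF; apply: so_open_bigcup. Qed.

Lemma zopen0 : zopen (set0 : set X).
Proof.
have <- : \bigcup_(V in set0) V = (set0 : set X) by rewrite bigcup_set0.
exact: zopen_bigcup.
Qed.

Let nbhds (P : set (set X)) (U : set X) : set (set X) :=
  [set V | [/\ zopen V, V `<=` U & P V]].

Let nbhds_cover P U :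
  (forall x, U x -> exists V, [/\ zopen V, V x, V `<=` U & P V]) ->
  U = \bigcup_(V in nbhds P U) V.
Proof.
move=> UP; apply/seteqP; split=> [x /UP[V [oV Vx VU PV]]|x [V [_ VU _] /VU//]].
by exists V.
Qed.

Lemma zopen_local (U : set X) :
  (forall x, U x -> exists V, [/\ zopen V, V x & V `<=` U]) -> zopen U.
Proof.
move=> Uo; rewrite (@nbhds_cover setT U); first by apply: zopen_bigcup => V [].
by move=> x /Uo[V [oV Vx VU]]; exists V.
Qed.

Lemma regular_on_local (U : set X) f :
  (forall x, U x ->
    exists V, [/\ zopen V, V x, V `<=` U & regular_on V f]) ->
  regular_on U f.
Proof.
move=> Uf; rewrite (@nbhds_cover [set V | regular_on V f] U) //.
by apply: so_regular_glue => V [].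
Qed.

End LocalCriteria.

Section Morphisms.
Variable R : realType.
Implicit Types X Y Z : fspace R.

Lemma fmorphism_id X : fmorphism (@id X).
Proof. by []. Qed.

Lemma fmorphism_comp X Y Z (f : X -> Y) (g : Y -> Z) :
  fmorphism f -> fmorphism g -> fmorphism (g \o f).
Proof.
move=> mf mg V oV; have [oW rW] := mg V oV; have [oU rU] := mf _ oW.
by split=> // h rh; exact: rU (rW _ rh).
Qed.

Lemma fmorphism_cst X Y (y : Y) : fmorphism (fun _ : X => y).
Proof.
move=> V oV; rewrite preimage_cst; case: ifPn => _; split=> [|g _].
- exact: so_openT.
- by apply: so_regular_cst; exact: so_openT.
- exact: zopen0.
- by apply: regular_on_local => x [].
Qed.

Section Initial.
Variables (T : choiceType) (S : set T -> set (T -> Cplx R)).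

Lemma generated_sub1 D f : generated S D f -> generated S D (fun=> 1).
Proof.
move=> Df; have := Gen_add (Gen_mul Df (Gen_cst S 0)) (Gen_cst S 1).
rewrite !setIT; set k := (fun _ => _); suff -> : k = (fun=> 1) by [].
by apply/funext => x; rewrite /k mulr0 add0r.
Qed.

Lemma initial_base D f : S D f ->
  zopen (D : set (FSpace (initial_on S))) /\
  regular_on (D : set (FSpace (initial_on S))) f.
Proof.
move=> SDf; have gf := Gen_base SDf; have g1 := generated_sub1 gf.
suff: init_open S D /\ init_regular S D f by [].
split=> x Dx; first by exists D, (fun=> 1).
exists D, f, (fun=> 1); split=> //.
by move=> y _ _ _; rewrite divr1.
Qed.

(** The universal property of an initial structure; the generated functions are
    handled first because opens and regular functions are built from them by
    non-vanishing loci and quotients. *)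
Lemma fmorphism_initial X (phi : X -> FSpace (initial_on S)) :
  (forall D f, S D f ->
    zopen (phi @^-1` D) /\ regular_on (phi @^-1` D) (f \o phi)) ->
  fmorphism phi.
Proof.
move=> Sphi.
have gen D f : generated S D f ->
    zopen (phi @^-1` D) /\ regular_on (phi @^-1` D) (f \o phi).
  elim=> {D f} [D f /Sphi//|c|D D' f g _ [oD rf] _ [oD' rg]
    |D D' f g _ [oD rf] _ [oD' rg]].
  - rewrite preimage_setT; split; first exact: so_openT.
    by apply: so_regular_cst; exact: so_openT.
  - rewrite preimage_setI.
    have oI : zopen (phi @^-1` D `&` phi @^-1` D') by exact: so_openI.
    split=> //; apply: (so_regularD oI).
    + by apply: (so_regular_restr _ _ _ rf) => // x [].
    + by apply: (so_regular_restr _ _ _ rg) => // x [].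
  - rewrite preimage_setI.
    have oI : zopen (phi @^-1` D `&` phi @^-1` D') by exact: so_openI.
    split=> //; apply: (so_regularM oI).
    + by apply: (so_regular_restr _ _ _ rf) => // x [].
    + by apply: (so_regular_restr _ _ _ rg) => // x [].
move=> V oV; have oU : zopen (phi @^-1` V).
  apply: zopen_local => x /oV[D [g [/gen[oD rg] Dx gx sV]]].
  exists (phi @^-1` D `&` [set y | g (phi y) != 0]); split=> //.
    exact: so_openD rg.
  by move=> y [Dy gy]; exact: sV.
split=> // f rf; apply: regular_on_local => x Ux.
have [D [g [h [/gen[oD rg] /gen[_ rh] Dx hx fE]]]] := rf _ Ux.
pose W := phi @^-1` D `&` [set y | h (phi y) != 0].
have oW : zopen W by exact: so_openD rh.
exists (W `&` phi @^-1` V); split=> //; first exact: so_openI.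
apply: (@so_regular_ext _ _ _ _ (fun y => g (phi y) * (h (phi y))^-1)).
- exact: so_openI.
- by move=> y [[Dy hy] Uy]; rewrite /= -fE.
apply: so_regularM; first exact: so_openI.
- by apply: (so_regular_restr _ _ _ rg); [|exact: so_openI|move=> y [[]]].
- apply: (@so_regular_restr _ _ (str X) W); [|exact: so_openI|by move=> y []|].
    by [].
  exact: so_regularV rh.
Qed.

Lemma initial_fmorphism X (phi : T -> X) :
  (forall U g, zopen U -> regular_on U g -> S (phi @^-1` U) (g \o phi)) ->
  @fmorphism R (FSpace (initial_on S)) X phi.
Proof.
move=> Sphi U oU; split=> [|g rg].
  exact: (initial_base (Sphi U (fun=> 0) oU (so_regular_cst _ oU))).1.
exact: (initial_base (Sphi U g oU rg)).2.
Qed.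

End Initial.

Lemma fmorphism_induced Z (T : choiceType) (i : T -> Z) :
  @fmorphism R (Defs.induced i) Z i.
Proof. by apply: initial_fmorphism => W g oW rg; exists W, g. Qed.

Lemma fmorphism_fst X Y : @fmorphism R (prod_space X Y) X fst.
Proof. by apply: initial_fmorphism => U g oU rg; left; exists U, g. Qed.

Lemma fmorphism_snd X Y : @fmorphism R (prod_space X Y) Y snd.
Proof. by apply: initial_fmorphism => U g oU rg; right; exists U, g. Qed.

Lemma fmorphism_pair Z X Y (f : Z -> X) (g : Z -> Y) :
  fmorphism f -> fmorphism g ->
  @fmorphism R Z (prod_space X Y) (fun z => (f z, g z)).
Proof.
move=> mf mg; apply: fmorphism_initial => D k [[U [h [oU rh -> ->]]]|].
  by have [oV rV] := mf U oU; split=> //; exact: rV.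
by move=> [U [h [oU rh -> ->]]]; have [oV rV] := mg U oU; split=> //; exact: rV.
Qed.

Lemma closed_immersion_fmorphism Y Z (i : Y -> Z) :
  closed_immersion i -> fmorphism i.
Proof.
case=> _ _ oi ri W oW; have [oU rU] := fmorphism_induced i oW.
by have oY := (oi _).2 oU; split=> // g rg; apply/ri => //; exact: rU.
Qed.

Lemma regular_coordinate n (j : 'I_n) :
  @regular_on R (affine_space R n) setT (fun x => x ord0 j).
Proof.
by have [] := @initial_base _ (fun (D : set 'rV[Cplx R]_n) f =>
    D = setT /\ exists i, f = fun x => x ord0 i) setT (fun x => x ord0 j) _;
  [split=> //; exists j|].
Qed.

End Morphisms.

(** * Convergence in the Euclidean topology *)

(** Convergence of a family along a filter, as opposed to a filter on the
    space itself, is what orbits, ultrafilters and Gm-limits have in common. *)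
Definition econv (R : realType) (X : fspace R) (T : Type) (F : set_system T)
    (u : T -> X) (x : X) : Prop :=
  (u : T -> euclidean X) @ F --> (x : euclidean X).

Section Convergence.
Variable R : realType.
Implicit Types X Y Z : fspace R.

Lemma open_subbase X (A : set (euclidean X)) :
  euclidean_subbase A -> open A.
Proof.
move=> sA; exists [set A] => [_ ->|]; first exact: (finI_from1 id sA).
by rewrite bigcup_set1.
Qed.

Lemma econvP X (T : Type) (F : set_system T) {FF : Filter F} (u : T -> X) x :
  econv F u x <-> forall (U : set X) (f : X -> Cplx R),
    zopen U -> regular_on U f -> U x ->
    F (u @^-1` U) /\ f \o u @ F --> f x.
Proof.
split=> [ux U f oU rf Ux|ux A].
  have oO (O : set (Cplx R)) : open O -> O (f x) ->
      F (u @^-1` (U `&` f @^-1` O)).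
    move=> oO Ofx; apply: ux; apply: open_nbhs_nbhs; split=> //.
    by apply: open_subbase; exists U, f, O.
  split; first by have := oO _ openT I; rewrite preimage_setT setIT.
  move=> A nA; apply: (@filterS _ F _ _ _ _ (oO _ (@open_interior _ A) nA)).
  by move=> t [_ /interior_subset].
rewrite (@nbhsE (euclidean X)) => /= -[_ [[B sB <-] [C BC Cx] sA]].
apply: (@filterS _ F _ (u @^-1` C)).
  by move=> t Ct; apply: sA; exists C.
have /sB [D sD IDeC] := BC; rewrite -IDeC preimage_bigcap.
apply: filter_bigI => E DE; have /set_mem[U [f [W [oU rf oW EE]]]] := sD _ DE.
have : E x by move: Cx; rewrite -IDeC => /(_ _ DE).
rewrite EE => -[Ux Wfx]; have [FU fu] := ux U f oU rf Ux.
by apply: filterI => //; apply: fu; exact: open_nbhs_nbhs.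
Qed.

Lemma econv_fmorphism X Y (T : Type) (F : set_system T) {FF : Filter F}
    (phi : X -> Y) (u : T -> X) x :
  fmorphism phi -> econv F u x -> econv F (phi \o u) (phi x).
Proof.
move=> mphi /econvP ux; apply/econvP => U f oU rf Ux.
by have [oV /(_ _ rf) rV] := mphi U oU; exact: (ux _ _ oV rV Ux).
Qed.

Lemma fmorphism_continuous X Y (phi : X -> Y) : fmorphism phi ->
  continuous (phi : euclidean X -> euclidean Y).
Proof. by move=> mphi x; apply: (@econv_fmorphism X Y _ (nbhs x) _ phi id). Qed.

Lemma regular_cvg X (T : Type) (F : set_system T) {FF : Filter F}
    (f : X -> Cplx R) (u : T -> X) x :
  regular_on setT f -> econv F u x -> f (u t) @[t --> F] --> f x.
Proof.
by move=> rf /econvP/(_ setT f (so_openT _) rf I)[].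
Qed.

Lemma econv_cst X (T : Type) (F : set_system T) {FF : Filter F} (x : X) :
  econv F (fun=> x) x.
Proof. exact: cvg_cst. Qed.

Lemma econv_near X (T : Type) (F : set_system T) {FF : Filter F}
    (u v : T -> X) x :
  F [set t | u t = v t] -> econv F u x -> econv F v x.
Proof.
move=> uv ux A nA; have Au : F (u @^-1` A) := ux A nA.
by apply: (@filterS _ F _ _ _ _ (filterI uv Au)) => t [/= <-].
Qed.

(** It suffices to test on the functions that generate the structure, as limits
    commute with sums, products and quotients. *)
Lemma econv_initial (Q : choiceType) (S : set Q -> set (Q -> Cplx R))
    (T : Type) (F : set_system T) {FF : Filter F} (u : T -> Q) (x : Q) :
  (forall D f, S D f -> D x ->
    F (u @^-1` D) /\ f \o u @ F --> f x) ->
  @econv R (FSpace (initial_on S)) T F u x.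
Proof.
move=> Su; have gen D f : generated S D f -> D x ->
    F (u @^-1` D) /\ f \o u @ F --> f x.
  elim=> {D f} [D f /Su//|c _|D D' f g _ Df _ Dg [Dx Dx']
    |D D' f g _ Df _ Dg [Dx Dx']].
  - by split; [rewrite preimage_setT; exact: filterT|exact: cvg_cst].
  - have [FD fu] := Df Dx; have [FD' gu] := Dg Dx'.
    by split; [exact: filterI|exact: (cvgD fu gu)].
  - have [FD fu] := Df Dx; have [FD' gu] := Dg Dx'.
    by split; [exact: filterI|exact: (cvgM fu gu)].
have ne0 D g : generated S D g -> D x -> g x != 0 ->
    F [set t | D (u t) /\ g (u t) != 0].
  move=> Dg Dx gx; have [FD gu] := gen D g Dg Dx.
  by apply: filterI => //; exact: (cvgr_neq0 _ gu gx).
apply/(@econvP (FSpace (initial_on S))) => U f oU rf Ux.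
have FU : F (u @^-1` U).
  have [D [g [Dg Dx gx sU]]] := oU x Ux.
  by apply: filterS (ne0 D g Dg Dx gx) => t [Dt gt]; exact: sU.
split=> //; have [D [g [h [Dg Dh Dx hx fE]]]] := rf x Ux.
have [_ gu] := gen D g Dg Dx; have [_ hu] := gen D h Dh Dx.
have quo : (fun t => g (u t) * (h (u t))^-1) @ F --> g x * (h x)^-1.
  exact: (cvgM gu (cvgV hx hu)).
rewrite (fE x Ux Dx hx); apply: cvg_trans quo; apply: near_eq_cvg.
apply: (@filterS _ F _ _ _ _ (filterI FU (ne0 D h Dh Dx hx))).
by move=> t [Ut [Dt ht]]; rewrite /= (fE _ Ut Dt ht).
Qed.

Lemma econv_induced Z (Q : choiceType) (i : Q -> Z) (T : Type)
    (F : set_system T) {FF : Filter F} (u : T -> Q) (x : Q) :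
  econv F (i \o u) (i x) -> @econv R (Defs.induced i) T F u x.
Proof.
move=> /econvP iu; apply: econv_initial => _ _ [W [g [oW rg -> ->]]] Wx.
exact: (iu W g).
Qed.

Lemma econv_pair X Y (T : Type) (F : set_system T) {FF : Filter F}
    (u : T -> X * Y) (z : X * Y) :
  econv F (fst \o u) z.1 -> econv F (snd \o u) z.2 ->
  @econv R (prod_space X Y) T F u z.
Proof.
move=> /econvP u1 /econvP u2; apply: econv_initial => D f [] [W [g]].
  by move=> [oW rg -> ->] Wx; exact: (u1 W g).
by move=> [oW rg -> ->] Wx; exact: (u2 W g).
Qed.

Lemma econv_affine n (T : Type) (F : set_system T) {FF : Filter F}
    (u : T -> 'rV[Cplx R]_n) (z : 'rV[Cplx R]_n) :
  (forall j, u t ord0 j @[t --> F] --> z ord0 j) ->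
  @econv R (affine_space R n) T F u z.
Proof.
move=> uz; apply: econv_initial => _ _ [-> [j ->]] _.
by split; [exact: filterT|exact: uz].
Qed.

Lemma zclosed_econv X (A : set X) (T : Type) (F : set_system T)
    {FF : ProperFilter F} (u : T -> X) x :
  zclosed A -> F (u @^-1` A) -> econv F u x -> A x.
Proof.
move=> cA FA /econvP ux; apply: contrapT => nAx.
have [FnA _] := ux (~` A) (fun=> 0) cA (so_regular_cst _ cA) nAx.
by have [t []] := filter_ex (filterI FA FnA).
Qed.

(** A closed immersion identifies its source with a closed subspace, so that a
    family converges as soon as its image does. *)
Lemma closed_immersion_econv Y Z (i : Y -> Z) (T : Type) (F : set_system T)
    {FF : ProperFilter F} (u : T -> Y) z :
  closed_immersion i -> econv F (i \o u) z ->
  exists2 y, i y = z & econv F u y.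
Proof.
move=> [_ ci oi ri] iu; have [y _ iy] : range i z.
  by apply: (zclosed_econv ci) iu; apply: filterS filterT => t _; exists (u t).
exists y => //; have /econvP iuy : @econv R (Defs.induced i) T F u y.
  by apply: econv_induced; rewrite iy.
apply/econvP => U f oU rf Uy; apply: iuy => //; first exact/oi.
exact/ri.
Qed.

Lemma separated_econv_unique X (T : Type) (F : set_system T)
    {FF : ProperFilter F} (u : T -> X) x y :
  Defs.separated X -> econv F u x -> econv F u y -> x = y.
Proof.
move=> sX ux uy.
pose uu t := (u t, u t).
apply: (@zclosed_econv (prod_space X X) _ T F _ uu (x, y) sX).
  by apply: filterS filterT => t _.
exact: econv_pair.
Qed.

(** The diagonal of an affine variety is cut out by the differences of the
    coordinate functions. *)
Lemma affine_variety_separated X : affine_variety X -> Defs.separated X.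
Proof.
move=> [n [i ci]]; have mi := closed_immersion_fmorphism ci.
have [inji _ _ _] := ci.
apply: zopen_local => -[x y] /= nxy.
have [j nj] : exists j, i x ord0 j != i y ord0 j.
  apply: contrapT => /forallNP ij; apply: nxy; apply: inji; apply/rowP => j.
  by apply/eqP/negPn/negP/ij.
have reg (q : (X * X)%type -> X) : @fmorphism R (prod_space X X) X q ->
    @regular_on R (prod_space X X) setT (fun z => i (q z) ord0 j).
  move=> mq.
  have [_ r] := fmorphism_comp mq mi (so_openT (str (affine_space R n))).
  exact: r _ (regular_coordinate j).
have r1 := reg _ (@fmorphism_fst R X X).
have r2 := reg _ (@fmorphism_snd R X X).
pose d := fun z : (X * X)%type => i z.1 ord0 j + -1 * i z.2 ord0 j.
have oT : zopen (setT : set (prod_space X X)) by exact: so_openT.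
exists (setT `&` [set z | d z != 0]); split.
- apply: so_openD => //; apply: so_regularD => //.
  by apply: so_regularM => //; exact: so_regular_cst.
- by split=> //=; rewrite /d /= mulN1r subr_eq0.
- by move=> [x' y'] [_] /= /eqP dz xy; apply: dz; rewrite /d /= xy mulN1r subrr.
Qed.

End Convergence.

(** * Compactness of bounded families of complex numbers *)

Section ComplexLimits.
Variable R : realType.
Local Open Scope complex_scope.

Lemma cvg_complex_of_real (T : Type) (F : set_system T) {FF : Filter F}
    (r : T -> R) (a : R) :
  r @ F --> a -> ((r t)%:C : Cplx R) @[t --> F] --> (a%:C : Cplx R).
Proof.
move=> ra; apply/cvgrPdist_lt => e e0.
have eE : e = (complex.Re e)%:C by rewrite RRe_real // gtr0_real.
have e0' : 0 < complex.Re e by rewrite -ltcR -eE.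
apply: (@filterS _ F _ _ _ _ ((cvgrPdist_lt _ _).1 ra _ e0')) => t at_.
rewrite eE -rmorphB /= normc_def /= expr0n addr0 sqrtr_sqr.
by rewrite ltcR.
Qed.

Lemma continuous_Re : continuous (@complex.Re R : Cplx R -> R).
Proof.
move=> z; apply/(@cvgrPdist_lt _ _ _ (nbhs z)) => e e0.
have e0' : 0 < (e%:C : Cplx R) by rewrite ltcR.
near=> t; rewrite -ltcR -[complex.Re z - _](raddfB (@complex.Re R)).
apply: le_lt_trans (normc_ge_Re (z - t)) _; near: t.
have zz := @cvg_id _ (nbhs (z : Cplx R)); exact: (cvgr_dist_lt _ _ zz _ e0').
Unshelve. all: by end_near. Qed.

Lemma ultrafilter_fmap (T U : Type) (F : set_system T) (u : T -> U) :
  UltraFilter F -> UltraFilter (u @ F).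
Proof.
move=> FU; split=> [|G PG uFG]; first exact: fmap_proper_filter.
apply/seteqP; split=> // A GA.
have [//|FnA] := in_ultra_setVsetC (u @^-1` A) FU.
have GnA : G (~` A) by apply: uFG.
by have [x []] := filter_ex (filterI GA GnA).
Qed.

Let ultra_real (T : Type) (F : set_system T) (r : T -> R) :
  UltraFilter F -> (forall t, `|r t| <= 1) -> exists a : R, r @ F --> a.
Proof.
move=> FU r1; have := @segment_compact R (-1) 1; rewrite compact_ultra.
move=> /(_ (r @ F) (ultrafilter_fmap r FU)) [|a [_ ra]]; last by exists a.
apply: (@filterS _ F _ _ _ _ (@filterT _ F _)) => t _ /=.
by rewrite in_itv /= -ler_norml.
Qed.

(** Closed discs are compact. *)
Lemma ultra_complex (T : Type) (F : set_system T) (z : T -> Cplx R) :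
  UltraFilter F -> (forall t, `|z t| <= 1) -> exists c : Cplx R, z @ F --> c.
Proof.
move=> FU z1.
have [|a ra] := @ultra_real T F (fun t => complex.Re (z t)) FU.
  by move=> t; rewrite -lecR; apply: le_trans (normc_ge_Re _) (z1 t).
have [|b ib] := @ultra_real T F (fun t => complex.Im (z t)) FU.
  move=> t; rewrite -lecR; apply: le_trans (z1 t).
  rewrite normc_def lecR -sqrtr_sqr ler_sqrt ?lerDr ?sqr_ge0 //.
  by rewrite addr_ge0 ?sqr_ge0.
exists (a%:C + 'i%C * b%:C).
have -> : z = (fun t => (complex.Re (z t))%:C + 'i%C * (complex.Im (z t))%:C).
  by apply/funext => t; rewrite -complexE.
apply: (@cvgD _ (Cplx R)); first exact: cvg_complex_of_real.
by apply: (@cvgM (Cplx R)); [exact: cvg_cst|exact: cvg_complex_of_real].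
Qed.

Lemma max_norm_coord n (v : 'rV[Cplx R]_n.+1) :
  exists k, forall j, `|v ord0 j| <= `|v ord0 k|.
Proof.
have nE (z : Cplx R) : `|z| = (complex.Re `|z|)%:C by rewrite RRe_real.
exists [arg max_(k > ord0) complex.Re `|v ord0 k|]%O.
case: arg_maxP => // k _ kmax j; rewrite nE [leRHS]nE lecR.
exact: kmax.
Qed.

End ComplexLimits.

(** * Projective space *)

Section Projective.
Variables (R : realType) (n : nat).
Local Notation P := (proj_space R n).

(** Some homogeneous coordinates of a point. *)
Definition hcoords (L : P) : 'rV[Cplx R]_n.+1 := vpick (sval L).

Definition ratio (k j : 'I_n.+1) (L : P) : Cplx R :=
  hcoords L ord0 j / hcoords L ord0 k.

Lemma hcoords_neq0 (L : P) : hcoords L != 0.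
Proof.
rewrite /hcoords vpick0; apply: contraTN (svalP L) => /eqP ->.
by rewrite dimv0.
Qed.

Lemma hcoords_exists (L : P) : exists k, hcoords L ord0 k != 0.
Proof.
apply: contrapT => /forallNP h0; have /negP := hcoords_neq0 L; apply.
by apply/eqP/rowP => k; rewrite mxE; apply/eqP/negPn/negP/h0.
Qed.

Lemma hcoords_line (v : punctured_space R n.+1) :
  exists2 a, a != 0 & hcoords (line v : P) = a *: sval v.
Proof.
have /vlineP[a ha] := memv_pick (sval (line v)).
exists a; last exact: ha.
apply: contraNneq (hcoords_neq0 (line v)) => a0.
by rewrite /hcoords [vpick _]ha a0 scale0r.
Qed.

Lemma line_eq (L : P) (v : punctured_space R n.+1) a :
  sval v = a *: hcoords L -> line v = L.
Proof.
move=> vE; apply/val_inj/eqP; rewrite /= eqEdim.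
rewrite (eqP (svalP L)) dim_vline (svalP v) leqnn andbT.
by rewrite -memvE vE memvZ // memv_pick.
Qed.

Lemma ratio_line k j (v : punctured_space R n.+1) :
  ratio k j (line v) = (sval v) ord0 j / (sval v) ord0 k.
Proof.
have [a a0 hE] := hcoords_line v; rewrite /ratio hE !mxE.
by rewrite -mulf_div divff // mul1r.
Qed.

Lemma fmorphism_line : @fmorphism R (punctured_space R n.+1) P (@line R n).
Proof. by []. Qed.

Lemma regular_punctured j :
  regular_on setT (fun v : punctured_space R n.+1 => sval v ord0 j).
Proof.
have [_ r] := @fmorphism_induced R (affine_space R n.+1)
  {v : 'rV[Cplx R]_n.+1 | v != 0} sval setT (so_openT (str _)).
exact: r _ (regular_coordinate j).
Qed.

Lemma line_chart k : (@line R n : punctured_space R n.+1 -> P) @^-1`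
    [set L : P | hcoords L ord0 k != 0] =
  setT `&` [set v : punctured_space R n.+1 | sval v ord0 k != 0].
Proof.
apply/seteqP; split=> [v /=|v [_ /=]]; have [a a0 ->] := hcoords_line v;
  by rewrite !mxE mulf_eq0 (negPf a0).
Qed.

Let oT : zopen (setT : set (punctured_space R n.+1)) := so_openT (str _).

Lemma zopen_chart k : zopen [set L : P | hcoords L ord0 k != 0].
Proof.
suff : zopen ((@line R n : punctured_space R n.+1 -> P) @^-1`
  [set L : P | hcoords L ord0 k != 0]) by [].
rewrite line_chart; exact: (so_openD oT (regular_punctured k)).
Qed.

Lemma regular_ratio k j :
  regular_on [set L : P | hcoords L ord0 k != 0] (ratio k j).
Proof.
suff : regular_on ((@line R n : punctured_space R n.+1 -> P) @^-1`
  [set L : P | hcoords L ord0 k != 0]) (ratio k j \o @line R n) by [].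
have oV := so_openD oT (regular_punctured k).
have -> : ratio k j \o @line R n = (fun v : punctured_space R n.+1 =>
    sval v ord0 j * (sval v ord0 k)^-1).
  by apply/funext => v; rewrite /= ratio_line.
rewrite line_chart; apply: (so_regularM oV).
- exact: (so_regular_restr oT oV _ (regular_punctured j)).
- exact: (so_regularV oT (regular_punctured k)).
Qed.

Lemma econv_line (T : Type) (F : set_system T) {FF : Filter F}
    (u : T -> P) (v : T -> 'rV[Cplx R]_n.+1) (w : punctured_space R n.+1) :
  (forall j, v t ord0 j @[t --> F] --> sval w ord0 j) ->
  F [set t | exists2 a, a != 0 & v t = a *: hcoords (u t)] ->
  econv F u (line w).
Proof.
move=> vw uv; pose v' t : punctured_space R n.+1 := insubd w (v t).
have Fv' : F [set t | sval (v' t) = v t /\ line (v' t) = u t].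
  apply: filterS uv => t [a a0 va]; have v0 : v t != 0.
    by rewrite va scaler_eq0 negb_or a0 hcoords_neq0.
  have v'E : sval (v' t) = v t.
    have := val_insubd (w : {v : 'rV[Cplx R]_n.+1 | v != 0}) (v t).
    by rewrite v0.
  by split=> //; apply: (line_eq (a := a)); rewrite v'E.
apply: (@econv_near R P T F _ (@line R n \o v')).
  by apply: filterS Fv' => t [].
apply: (econv_fmorphism fmorphism_line); apply: econv_induced.
apply: econv_affine => j; apply: cvg_trans (vw j); apply: near_eq_cvg.
by apply: filterS Fv' => t [] /= ->.
Qed.

(** Scaling homogeneous coordinates so that the largest one is 1 keeps them in
    the unit polydisc and keeps their limit away from 0. *)
Lemma proj_space_ultra (T : Type) (F : set_system T) (u : T -> P) :
  UltraFilter F -> exists L, econv F u L.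
Proof.
move=> FU.
pose A k := [set t | forall j,
  `|hcoords (u t) ord0 j| <= `|hcoords (u t) ord0 k|].
have [k Fk] : exists k, F (A k).
  apply: contrapT => /forallNP nA.
  have : \forall t \near F, forall k, ~ A k t.
    by apply: filter_forall => k; have [/nA|] := in_ultra_setVsetC (A k) FU.
  move=> /filter_ex[t nAt]; have [k kmax] := max_norm_coord (hcoords (u t)).
  exact: (nAt k).
pose z j t : Cplx R := if `|ratio k j (u t)| <= 1 then ratio k j (u t) else 0.
have cz j : exists c : Cplx R, z j @ F --> c.
  apply: ultra_complex => t; rewrite /z; case: ifP => // _.
  by rewrite normr0 ler01.
pose c j := sval (cid (cz j)).
have zc j : z j @ F --> c j := svalP (cid (cz j)).
have zE t : A k t ->
    hcoords (u t) ord0 k != 0 /\ forall j, z j t = ratio k j (u t).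
  move=> At; have hk : hcoords (u t) ord0 k != 0.
    have [j hj] := hcoords_exists (u t); rewrite -normr_gt0.
    by apply: lt_le_trans (At j); rewrite normr_gt0.
  split=> // j; rewrite /z ifT // /ratio normrM normfV.
  by rewrite ler_pdivrMr ?normr_gt0 // mul1r.
have ck : c k = 1.
  have zk1 : z k @ F --> (1 : Cplx R).
    apply: cvg_trans (@cvg_cst (Cplx R) 1 T F _); apply: near_eq_cvg.
    by apply: filterS Fk => t /zE[hk ->]; rewrite /ratio divff.
  exact: (cvg_unique _ (zc k) zk1).
have w0 : \row_j c j != 0 :> 'rV[Cplx R]_n.+1.
  apply/eqP => /rowP/(_ k); rewrite !mxE ck; apply/eqP; exact: oner_neq0.
pose w : punctured_space R n.+1 := exist (fun v => is_true (v != 0)) _ w0.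
exists (line w).
apply: (@econv_line T F _ u (fun t => \row_j z j t)) => [j|].
  rewrite /= mxE; under eq_cvg do rewrite mxE; exact: zc.
apply: filterS Fk => t /zE[hk zt]; exists (hcoords (u t) ord0 k)^-1.
  by rewrite invr_eq0.
by apply/rowP => j; rewrite !mxE zt mulrC.
Qed.

End Projective.

(** Properness of projective morphisms.  An ultrafilter on [A] converges in [X]
    because [K] is compact, and in projective space because that is compact;
    hence it converges in their product, where the image of [Y] is closed. *)
Lemma projective_compact (R : realType) (Y X : fspace R) (p : Y -> X)
    (K : set (euclidean X)) (A : set (euclidean Y)) :
  projective_morphism p -> compact K -> p @` A `<=` K ->
  (forall G (y : Y), UltraFilter G -> G A -> econv G id y -> A y) ->
  compact A.
Proof.
move=> [n [i [ci ip]]]; rewrite !compact_ultra => cK AK clA G GU GA.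
have mi := closed_immersion_fmorphism ci.
have [] := cK (p @ G) (ultrafilter_fmap p GU).
  by apply: (@filterS _ G _ _ _ _ GA) => y Ay; apply: AK; exists y.
move=> x [Kx px]; have [L uL] := proj_space_ultra (fun y => (i y).2) GU.
have [|y iy uy] := @closed_immersion_econv _ _ _ i _ G _ id (x, L) ci.
  apply: econv_pair => //=; rewrite /econv.
  by have -> : fst \o (i \o id) = p by apply/funext => y; exact: ip.
by exists y; split; [exact: (clA G y)|].
Qed.

(** * Rational functions on Gm near 0 *)

Section GmLimits.
Variable R : realType.
Local Notation C := (Cplx R).
Local Notation to0 := (@gm_to0 R).

Lemma gm_val_neq0 (t : Gm R) : gm_val t != 0.
Proof. exact: (svalP t). Qed.

Lemma gm_valM (s t : Gm R) : gm_val (s * t)%g = gm_val s * gm_val t.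
Proof. by []. Qed.

Lemma gm_to0E (A : set (Gm R)) :
  to0 A = nbhs (0 : C) [set z | forall t, gm_val t = z -> A t].
Proof. by []. Qed.

Global Instance gm_to0_proper : ProperFilter to0.
Proof.
apply: Build_ProperFilter_ex => [A A0|].
  have A0' := @nbhs_dnbhs C 0 _ A0.
  have [z [Az z0]] := filter_ex (filterI A0' (@nbhs_dnbhs_neq C 0)).
  by exists (exist (fun t : C => is_true (t != 0)) z z0); exact: Az.
split=> [|A B|A B AB]; rewrite !gm_to0E; first by apply: filterS filterT.
- move=> A0 B0; apply: filterS (filterI A0 B0) => z [Az Bz] t tz.
  by split; [exact: Az|exact: Bz].
- by apply: filterS => z Az t /Az/AB.
Qed.

Lemma gm_val_cvg0 : (@gm_val R) @ to0 --> (0 : C).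
Proof.
move=> A A0; suff : to0 (@gm_val R @^-1` A) by [].
rewrite gm_to0E; apply: (@filterS _ (nbhs (0 : C)) _ A _ _ A0) => z Az t tz.
by rewrite /= tz.
Qed.

Lemma gm_to0_mul (s : Gm R) (A : set (Gm R)) :
  to0 A -> to0 [set t | A (s * t)%g].
Proof.
move=> A0.
have cs : (fun z : C => gm_val s * z) @ (0 : C) --> (gm_val s * 0 : C).
  exact: (cvgM (@cvg_cst C (gm_val s) C (nbhs (0 : C)) _)
    (@cvg_id C (nbhs (0 : C)))).
rewrite mulr0 in cs; rewrite gm_to0E.
apply: (@filterS _ (nbhs (0 : C)) _ _ _ _ (cs _ A0)).
by move=> z Az t tz; apply: Az; rewrite gm_valM tz.
Qed.

Lemma horner_cvg (T : Type) (F : set_system T) {FF : Filter F} (u : T -> C)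
    (c : C) (P : {poly C}) : u @ F --> c -> P.[u t] @[t --> F] --> P.[c].
Proof.
move=> uc; elim/poly_ind: P => [|P a IH].
  by under eq_cvg do rewrite horner0; rewrite horner0; exact: cvg_cst.
under eq_cvg do rewrite hornerMXaddC; rewrite hornerMXaddC.
exact: (cvgD (cvgM IH uc) (@cvg_cst C a _ F _)).
Qed.

Lemma horner_cvg0 (P : {poly C}) : P.[gm_val t] @[t --> to0] --> P.[0].
Proof. exact: horner_cvg gm_val_cvg0. Qed.

(** A finite family of polynomials is divided by the largest power of ['X] that
    divides all of its members. *)
Lemma polys_order0 n (P : 'I_n -> {poly C}) k : P k != 0 ->
  exists a B, (forall j, P j = B j * 'X^a) /\ exists j : 'I_n, (B j).[0] != 0.
Proof.
have [N] := ubnP (size (P k)); elim: N => // N IH in P *.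
rewrite ltnS => sP Pk0.
have [[j Pj]|P0] := pselect (exists j, (P j).[0] != 0).
  by exists 0%N, P; split=> [i|]; [rewrite expr0 mulr1|exists j].
have PX j : exists B, P j = B * 'X.
  have /factor_theorem[B ->] : root (P j) 0.
    by apply/negPn/negP => Pj; apply: P0; exists j.
  by exists B; rewrite subr0.
pose P' j := sval (cid (PX j)).
have P'E j : P j = P' j * 'X := svalP (cid (PX j)).
have P'k : P' k != 0 by apply: contraNneq Pk0; rewrite P'E => ->; rewrite mul0r.
have [|//|a [B [BE [j Bj]]]] := IH P'.
  by apply: leq_trans sP; rewrite P'E size_mulX.
by exists a.+1, B; split; [move=> i; rewrite P'E BE exprSr mulrA|exists j].
Qed.

Lemma poly_order0 (P : {poly C}) : P != 0 ->
  exists a B, P = B * 'X^a /\ B.[0] != 0.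
Proof.
move=> P0; have [a [B [BE [j Bj]]]] := @polys_order0 1 (fun=> P) ord0 P0.
by exists a, (B j); split.
Qed.

Lemma near0_horner_neq0 (P : {poly C}) :
  P != 0 -> to0 [set t | P.[gm_val t] != 0].
Proof.
move=> /poly_order0[a [B [-> B0]]].
have B0' : to0 [set t | B.[gm_val t] != 0].
  exact: (cvgr_neq0 _ (@horner_cvg0 B) B0).
apply: (@filterS _ to0 _ _ _ _ B0') => t Bt.
by rewrite /= hornerM hornerXn mulf_neq0 // expf_neq0 // gm_val_neq0.
Qed.

(** [f] is a quotient [P / Q] of polynomials around [t0].  As the zeros of [Q]
    are finite in number, [D] is cofinite, and what [P] and [Q] say about
    [f] near [t0] also holds near the missing point 0 of Gm. *)
Definition rational_at (D : set (Gm R)) (f : Gm R -> C) (t0 : Gm R) : Prop :=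
  exists P Q : {poly C}, Q.[gm_val t0] != 0 /\
    forall t, Q.[gm_val t] != 0 -> D t /\ f t * Q.[gm_val t] = P.[gm_val t].

(** Quotients of polynomials are stable under the operations that build the
    regular functions of an initial structure from the generating ones. *)
Lemma rational_initial (T : choiceType) (S : set T -> set (T -> C))
    (e : Gm R -> T) :
  (forall D f t0, S D f -> D (e t0) -> rational_at (e @^-1` D) (f \o e) t0) ->
  forall (U : set (FSpace (initial_on S))) f t0, zopen U -> regular_on U f ->
    U (e t0) -> rational_at (e @^-1` U) (f \o e) t0.
Proof.
move=> Se; have gen D f t0 : generated S D f -> D (e t0) ->
    rational_at (e @^-1` D) (f \o e) t0.
  move=> gD; elim: gD t0 => {D f} [D f /Se//|c t0 _
    |D D' f g _ IHf _ IHg t0 [/IHf[P [Q [Q0 PQ]]] /IHg[P' [Q' [Q'0 PQ']]]]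
    |D D' f g _ IHf _ IHg t0 [/IHf[P [Q [Q0 PQ]]] /IHg[P' [Q' [Q'0 PQ']]]]].
  - exists c%:P, 1; rewrite hornerC oner_neq0; split=> // t _.
    by rewrite /= !hornerC mulr1.
  - exists (P * Q' + P' * Q), (Q * Q'); rewrite hornerM mulf_neq0 //.
    split=> // t; rewrite hornerM mulf_eq0 negb_or.
    move=> /andP[/PQ[Dt fE] /PQ'[Dt' gE]].
    split=> //=; rewrite hornerD !hornerM -fE -gE /= mulrDl; congr (_ + _).
      by rewrite mulrA.
    by rewrite -mulrA [Q'.[_] * _]mulrC.
  - exists (P * P'), (Q * Q'); rewrite hornerM mulf_neq0 //.
    split=> // t; rewrite hornerM mulf_eq0 negb_or.
    move=> /andP[/PQ[Dt fE] /PQ'[Dt' gE]].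
    by split=> //=; rewrite !hornerM -fE -gE /= mulrACA.
move=> U f t0 oU rf Ut0.
have [D [g [Dg De ge sU]]] := oU _ Ut0.
have [P [Q [Q0 PQ]]] := gen _ _ _ Dg De.
have [D1 [a [b [D1a D1b D1e be fE]]]] := rf _ Ut0.
have [A [A' [A'0 AA']]] := gen _ _ _ D1a D1e.
have [B [B' [B'0 BB']]] := gen _ _ _ D1b D1e.
have [_ /= gQ0] := PQ _ Q0; have [_ /= bB0] := BB' _ B'0.
have P0 : P.[gm_val t0] != 0 by rewrite -gQ0 mulf_neq0.
have B0 : B.[gm_val t0] != 0 by rewrite -bB0 mulf_neq0.
exists (A * B' * B' * P * Q), (A' * B * B' * P * Q).
rewrite !hornerM !mulf_neq0 //; split=> // t.
rewrite !hornerM !mulf_eq0 !negb_or.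
move=> /andP[/andP[/andP[/andP[A't Bt] B't] Pt] Qt].
have [Dt /= gE] := PQ _ Qt; have [D1t /= aE] := AA' _ A't.
have [_ /= bE] := BB' _ B't.
have Ut : U (e t).
  by apply: sU => //; apply: contraNneq Pt => g0; rewrite -gE g0 mul0r.
have bt : b (e t) != 0 by apply: contraNneq Bt => b0; rewrite -bE b0 mul0r.
split=> //=; rewrite !mulrA; do 3 congr (_ * _).
rewrite -aE -bE.
have -> : a (e t) = f (e t) * b (e t) by rewrite (fE _ Ut D1t bt) divfK.
by rewrite mulrACA mulrA.
Qed.

End GmLimits.

Section GmMorphisms.
Variable R : realType.
Local Notation C := (Cplx R).
Local Notation to0 := (@gm_to0 R).

Lemma regular_gm_val : @regular_on R (Gm_space R) setT (@gm_val R).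
Proof.
have [_ r] := @fmorphism_induced R (affine_space R 1) (Gm R)
  (fun t => const_mx (gm_val t)) setT (so_openT (str _)).
have := r _ (regular_coordinate ord0); congr (regular_on _ _).
by apply/funext => t /=; rewrite mxE.
Qed.

Lemma regular_rational_at (U : set (Gm_space R)) (f : Gm_space R -> C) t0 :
  zopen U -> regular_on U f -> U t0 -> rational_at U f t0.
Proof.
move=> oU rf Ut0.
apply: (@rational_initial R _ _ (@id (Gm R)) _ U f t0) => //.
move=> _ _ t1 [W [g [oW rg -> ->]]] Wt1.
pose e (t : Gm R) : 'rV[C]_1 := const_mx (gm_val t).
apply: (@rational_initial R _ _ e _ W g t1) => //.
move=> _ _ t2 [-> [i ->]] _; exists 'X, 1; rewrite hornerC oner_neq0.
by split=> // t _; rewrite /= hornerC mulr1 hornerX mxE.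
Qed.

(** A rational function that is multiplicative has no zero or pole away from 0:
    after removing a power of [t] it tends to a finite nonzero limit [e0] at 0,
    and letting [t] tend to 0 in [e (s t) = e s * e t] gives [e0 = e s * e0]. *)
Lemma gm_endomorphism (chi : Gm R -> Gm R) :
  @fmorphism R (Gm_space R) (Gm_space R) chi ->
  (forall s t, chi (s * t)%g = (chi s * chi t)%g) ->
  exists k : int, forall t, gm_val (chi t) = gm_val t ^ k.
Proof.
move=> mchi chiM.
have [oU rU] := mchi setT (so_openT (str _)).
have [P [Q [Q1 PQ]]] :=
  regular_rational_at oU (rU _ regular_gm_val) (I : setT (chi 1%g)).
have Q0 : Q != 0 by apply: contraNneq Q1 => ->; rewrite horner0.
have P0 : P != 0.
  apply: contraNneq (Q1) => P0; have [_ /=] := PQ _ Q1.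
  by rewrite P0 horner0 => /eqP; rewrite mulf_eq0 (negPf (gm_val_neq0 _)).
have [a [A [PE A0]]] := poly_order0 P0; have [b [B [QE B0]]] := poly_order0 Q0.
pose e t := gm_val (chi t) * gm_val t ^ (b%:Z - a%:Z).
have eM s t : e (s * t)%g = e s * e t.
  by rewrite /e chiM !gm_valM exprzMl ?unitfE ?gm_val_neq0 // mulrACA.
have e0 : e @ to0 --> A.[0] / B.[0].
  have AB : (fun t => A.[gm_val t] / B.[gm_val t]) @ to0 --> A.[0] / B.[0].
    by apply: cvgM; [exact: horner_cvg0|apply: cvgV B0 _; exact: horner_cvg0].
  apply: cvg_trans AB; apply: near_eq_cvg.
  apply: (@filterS _ to0 _ _ _ _ (near0_horner_neq0 Q0)) => t Qt.
  have [_ /=] := PQ _ Qt; rewrite PE QE !hornerM !hornerXn => PQt.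
  have t0 := gm_val_neq0 t.
  have Bt : B.[gm_val t] != 0.
    by apply: contraNneq Qt => Bt; rewrite QE hornerM Bt mul0r.
  have ta0 := expf_neq0 a t0; have tb0 := expf_neq0 b t0.
  rewrite /e expfzDr // -invr_expz -!exprnP.
  have -> : gm_val (chi t) =
      A.[gm_val t] * gm_val t ^+ a / (B.[gm_val t] * gm_val t ^+ b).
    by rewrite -PQt mulfK // mulf_neq0.
  move: ta0 tb0; set u := _ ^+ a; set v := _ ^+ b => u0 v0.
  by field; rewrite Bt u0 v0.
have e1 s : e s = 1.
  have c1 : (fun t => e (s * t)%g) @ to0 --> A.[0] / B.[0].
    by move=> N /e0 eN; exact: (gm_to0_mul s eN).
  have c2 : (fun t => e (s * t)%g) @ to0 --> e s * (A.[0] / B.[0]).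
    under eq_cvg do rewrite eM.
    exact: (cvgM (@cvg_cst C (e s) _ to0 _) e0).
  have c12 : 1 * (A.[0] / B.[0]) = e s * (A.[0] / B.[0]).
    by rewrite mul1r; apply: (cvg_unique _ c1 c2).
  by apply/esym/(mulIf _ c12); rewrite mulf_neq0 // invr_eq0.
exists (a%:Z - b%:Z) => t.
have := e1 t; rewrite /e -opprB -invr_expz => /(canRL (mulfK _)) ->.
  by rewrite div1r invrK.
by rewrite invr_eq0 expfz_neq0 // gm_val_neq0.
Qed.

(** Near 0 the ratios of homogeneous coordinates are quotients of polynomials;
    clearing denominators and dividing by the largest common power of [t] gives
    homogeneous coordinates that extend to 0. *)
Lemma proj_space_limit n (h : Gm_space R -> proj_space R n) :
  fmorphism h -> exists L, econv to0 h L.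
Proof.
move=> mh; have [k hk] := hcoords_exists (h 1%g).
pose U := [set L : proj_space R n | hcoords L ord0 k != 0].
have [oV rV] := mh U (@zopen_chart R n k).
have /all_sig[P PQ] :
    forall j, {P : {poly C} | exists Q : {poly C}, Q.[1] != 0 /\
    forall t, Q.[gm_val t] != 0 ->
      (h @^-1` U) t /\ ratio k j (h t) * Q.[gm_val t] = P.[gm_val t]}.
  move=> j; apply: cid.
  have [P [Q [Q1 PQ]]] := @regular_rational_at (h @^-1` U)
    (ratio k j \o h) 1%g oV (rV _ (@regular_ratio R n k j)) hk.
  by exists P, Q.
have /all_sig[Q {}PQ] := fun j => cid (PQ j).
pose D := \prod_j Q j.
have D1 : D.[1] != 0.
  rewrite horner_prod; apply/prodf_neq0 => j _; exact: (PQ j).1.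
pose A j := P j * \prod_(i | i != j) Q i.
have AE t : D.[gm_val t] != 0 -> hcoords (h t) ord0 k != 0 /\
    forall j, (A j).[gm_val t] = ratio k j (h t) * D.[gm_val t].
  move=> Dt; have Qt j : (Q j).[gm_val t] != 0.
    by move: Dt; rewrite horner_prod => /prodf_neq0; exact.
  split=> [|j]; first exact: ((PQ k).2 _ (Qt k)).1.
  have -> : D = Q j * \prod_(i | i != j) Q i by rewrite /D (bigD1 j).
  rewrite /A !hornerM mulrA; congr (_ * _).
  by rewrite ((PQ j).2 _ (Qt j)).2.
have Ak : A k != 0.
  have [hk1 A1] := AE 1%g D1; apply: contraNneq D1 => Ak.
  have := A1 k; rewrite Ak horner0 /ratio divff // mul1r => <-.
  by [].
have [a [B [ABE [j0 Bj0]]]] := polys_order0 Ak.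
have w0 : \row_j (B j).[0] != 0 :> 'rV[C]_n.+1.
  by apply: contraNneq Bj0 => /rowP/(_ j0); rewrite !mxE => ->.
pose w : punctured_space R n.+1 := exist (fun v => is_true (v != 0)) _ w0.
exists (line w).
apply: (@econv_line R n _ to0 _ h (fun t => \row_j (B j).[gm_val t])) => [j|].
  by rewrite /= mxE; under eq_cvg do rewrite mxE; exact: horner_cvg0.
have D0 : D != 0 by apply: contraNneq D1 => ->; rewrite horner0.
apply: (@filterS _ to0 _ _ _ _ (near0_horner_neq0 D0)) => t Dt.
have [hkt At] := AE _ Dt; have t0 := expf_neq0 a (gm_val_neq0 t).
exists (D.[gm_val t] / hcoords (h t) ord0 k / gm_val t ^+ a).
  by rewrite !mulf_neq0 ?invr_eq0.
apply/rowP => j; rewrite !mxE.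
have := At j; rewrite ABE hornerM hornerXn /ratio => /(canRL (mulfK t0)) ->.
by rewrite [RHS]mulrC !mulrA; congr (_ / _); rewrite mulrAC.
Qed.

End GmMorphisms.

(** * Bounded regular functions on an affine variety *)

Lemma linear_dependence (K : fieldType) (I : finType) (N : nat)
    (M : 'I_N -> I -> K) : (#|I| < N)%N ->
  exists a : 'I_N -> K,
    (exists i, a i != 0) /\ forall m, \sum_i a i * M i m = 0.
Proof.
move=> IN; pose A := \matrix_(i < N, j < #|I|) M i (enum_val j).
have : kermx A != 0.
  rewrite -mxrank_eq0 mxrank_ker subn_eq0 -ltnNge.
  exact: leq_ltn_trans (rank_leq_col A) IN.
move=> /matrix0Pn[r [i ri]]; exists (fun j => kermx A r j).
split; first by exists i.
move=> m; have /matrixP/(_ r (enum_rank m)) := mulmx_ker A.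
rewrite [LHS]mxE [RHS]mxE => kA; rewrite -[RHS]kA; apply: eq_bigr => j _.
by congr (_ * _); rewrite mxE enum_rankK.
Qed.

(** Clearing denominators in [\sum_i a_i / (z - c_i) = 0] gives a polynomial
    equation for [z], nontrivial because the [c_i] are distinct. *)
Lemma partial_fraction_root (K : fieldType) (N : nat) (c a : 'I_N -> K) :
  injective c -> (exists i, a i != 0) ->
  exists2 P : {poly K}, P != 0 & forall z, (forall i, z != c i) ->
    \sum_i a i / (z - c i) = 0 -> root P z.
Proof.
move=> injc [i0 ai0].
pose P := \sum_i a i *: \prod_(j | j != i) ('X - (c j)%:P).
have PE z : P.[z] = \sum_i a i * \prod_(j | j != i) (z - c j).
  rewrite horner_sum; apply: eq_bigr => i _; rewrite hornerZ horner_prod.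
  by congr (_ * _); apply: eq_bigr => j _; rewrite hornerXsubC.
exists P => [|z zc S0].
  apply: contraNneq ai0 => P0; have := PE (c i0); rewrite P0 horner0.
  have S0 i : i != i0 -> a i * \prod_(j | j != i) (c i0 - c j) = 0.
    by move=> ii0; rewrite (bigD1 i0) 1?eq_sym //= subrr mul0r mulr0.
  rewrite (bigD1 i0) //= [X in _ + X]big1 // addr0 => /esym/eqP.
  rewrite mulf_eq0 => /orP[//|/prodf_eq0[j ji]].
  by rewrite subr_eq0 (inj_eq injc) eq_sym (negPf ji).
rewrite /root PE; apply/eqP.
have -> : \sum_i a i * \prod_(j | j != i) (z - c j) =
    (\sum_i a i / (z - c i)) * \prod_j (z - c j).
  rewrite mulr_suml; apply: eq_bigr => i _.
  by rewrite [in RHS](bigD1 i) //= -!mulrA mulKf // subr_eq0.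
by rewrite S0 mul0r.
Qed.

Lemma meval_bounded_degree (K : comNzRingType) m N (q : mpoly.mpoly m K)
    (v : 'I_m -> K) : (mpoly.msize q <= N)%N ->
  mpoly.meval v q = \sum_(e : mpoly.bmultinom m N)
    mpoly.mcoeff e q * \prod_i v i ^+ (mpoly.bmnm e) i.
Proof.
move=> /mpoly.mpolywE {1}->; rewrite raddf_sum; apply: eq_bigr => e _.
by rewrite /= mpoly.mevalZ mpoly.mevalX.
Qed.

Section BoundedRegular.
Variable R : realType.
Local Notation C := (Cplx R).
Local Open Scope complex_scope.

(** Countably many finite sets do not cover an interval. *)
Lemma infinite_fiber (deg : R -> nat) :
  exists N, infinite_set [set r | `[0, 1]%classic r /\ deg r = N].
Proof.
apply: contrapT => /forallNP fin.
have : countable (`[0, 1]%classic : set R).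
  have -> : (`[0, 1]%classic : set R) =
      \bigcup_N [set r | `[0, 1]%classic r /\ deg r = N].
    by apply/seteqP; split=> [r r01|r [N _ []//]]; exists (deg r).
  apply: bigcup_countable => [|N _]; first exact: countableP.
  by apply: finite_set_countable; apply: contrapT => /fin.
move=> /countable_lebesgue_measure0; rewrite lebesgue_measure_itv /=.
by rewrite lte_fin ltr01 oppr0 adde0 => /eqP; rewrite eqe oner_eq0.
Qed.

(** The functions [1 / (f - c)] with [c] large are regular, and there are
    uncountably many of them, whereas the coordinate ring has countable
    dimension: infinitely many of them are polynomials in the generators of the
    same degree.  A linear relation between these is an algebraic equation for
    [f]. *)
Lemma bounded_regular_root (X : fspace R) (m : nat) (g : 'I_m -> X -> C)
    (f : X -> C) (B : R) :
  generates_coord_ring g -> regular_on setT f ->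
  (forall x, complex.Re (f x) <= B) ->
  exists2 P : {poly C}, P != 0 & forall x, root P (f x).
Proof.
move=> [_ gen] rf fB.
pose c (r : R) : C := (B + 1 + r)%:C.
have fc (r : R) x : 0 <= r -> f x != c r.
  move=> r0; apply: contraTneq (fB x) => ->; rewrite -ltNge /=.
  by rewrite -addrA ltrDl ltr_pwDl.
have /all_sig[q qE] (r : {r : R | 0 <= r}) : {q : mpoly.mpoly m C |
    forall x, mpoly.meval (fun j => g j x) q = (f x - c (sval r))^-1}.
  apply: cid; have oT := so_openT (str X).
  have rfc : regular_on setT (fun x => f x + - c (sval r)).
    by apply: so_regularD => //; exact: so_regular_cst.
  have := so_regularV oT rfc; rewrite (_ : setT `&` _ = setT).
    by move=> /gen[q qE]; exists q => x; rewrite -qE.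
  by apply/seteqP; split=> // x _; split=> //=;
    rewrite subr_eq0 fc // (svalP r).
pose deg r := if insub r is Some r' then
  mpoly.msize (q r') else 0%N.
have [N infN] := infinite_fiber deg.
have [W WN cardW] := infinite_set_fset #|{: mpoly.bmultinom m N}|.+1 infN.
pose r (i : 'I_(#|` W|)) : R := tnth (in_tuple W) i.
have rW i : `[0, 1]%classic (r i) /\ deg (r i) = N.
  by apply: WN; rewrite /= mem_tnth.
have r_inj : injective r.
  by move=> i j; apply: (tuple_uniqP _ _); exact: fset_uniq.
have r_ge0 i : 0 <= r i.
  by have [] := rW i; rewrite /= in_itv /= => /andP[].
pose r' i : {r : R | 0 <= r} := exist (fun r => is_true (0 <= r)) _ (r_ge0 i).
have degr i : mpoly.msize (q (r' i)) = N.
  have [_ <-] := rW i; rewrite /deg; case: insubP => [s _ sr|].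
    by congr (mpoly.msize (q _)); apply/val_inj; rewrite sr.
  by rewrite r_ge0.
have [a [a0 aq]] := linear_dependence
  (fun i (e : mpoly.bmultinom m N) => mpoly.mcoeff e (q (r' i))) cardW.
have c_inj : injective (fun i => c (r i)).
  by move=> i j /complexI/addrI/r_inj.
have [P P0 rootP] := partial_fraction_root c_inj a0.
exists P => // x; apply: rootP => [i|]; first exact: fc.
under eq_bigr => i _.
  rewrite -(qE (r' i)) (meval_bounded_degree _ (eq_leq (degr i))) mulr_sumr.
  under eq_bigr do rewrite mulrA.
  over.
rewrite exchange_big /=; apply: big1 => e _.
by rewrite -mulr_suml aq mul0r.
Qed.

(** The fibres of a function with finitely many values are open and closed. *)
Lemma connected_root_constant (X : fspace R) (g : X -> C) (P : {poly C}) :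
  connected [set: euclidean X] -> regular_on setT g -> P != 0 ->
  (forall x, root P (g x)) -> constant_functions g.
Proof.
move=> conn rg P0 Pg.
have cg (Q : {poly C}) : continuous (fun x : euclidean X => Q.[g x]).
  move=> x; apply: (@horner_cvg _ _ (nbhs (x : euclidean X))).
  exact: (@regular_cvg _ _ _ (nbhs (x : euclidean X)) _ g id x rg
    (@cvg_id _ _)).
have closed0 : closed [set (0 : C)].
  apply: accessible_closed_set1.
  exact: hausdorff_accessible (@norm_hausdorff _ C).
have [[x _]|/forallNP nX] := pselect (exists x : X, True); last first.
  by exists 0 => x; case: (nX x).
(* Splitting off the root [g x] from [P] exhibits the fibre as [Q <> 0]. *)
have [n [Q QP PE]] := multiplicity_XsubC P (g x); rewrite P0 /= in QP.
exists (g x) => y.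
pose A : set (euclidean X) := [set y | g y = g x].
suff : A = setT by move=> /seteqP[_ /(_ y I)].
have Ax : A !=set0 by exists x.
apply: (conn A Ax); [exists A|exists A]; rewrite ?setTI //.
  have -> : A = (fun y => Q.[g y]) @^-1` (~` [set 0]).
    apply/seteqP; split=> z /= => [->|Qz]; first by apply/eqP.
    have := Pg z; rewrite PE /root hornerM mulf_eq0 => /orP[/eqP//|].
    by rewrite horner_exp hornerXsubC expf_eq0 subr_eq0 => /andP[_ /eqP].
  apply: open_comp => [z _|]; first exact: cg.
  exact: closed_openC.
have -> : A = (fun y => ('X - (g x)%:P).[g y]) @^-1` [set 0].
  apply/seteqP; split=> z /=; first by rewrite hornerXsubC => ->; rewrite subrr.
  by rewrite hornerXsubC => /eqP; rewrite subr_eq0 => /eqP.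
apply: (continuous_closedP _).1; first exact: cg.
exact: closed0.
Qed.

End BoundedRegular.

(** * Torus actions *)

Section Actions.
Variables (R : realType) (d : nat) (T : torus R d).
Local Notation C := (Cplx R).
Local Notation to0 := (@gm_to0 R).

Lemma torus_mulC (s t : T) : (s * t = t * s)%g.
Proof.
have [phi [_ [psi [_ phiK _]]] phiM] := torus_iso T.
apply: (can_inj phiK); rewrite !phiM; apply/ffunP => i.
by rewrite !ffunE; apply/val_inj; rewrite /= /gm_val /= mulrC.
Qed.

(** The pairing selects an exponent, which exists because the algebraic
    endomorphisms of Gm are the powers. *)
Lemma pairingE (v : Gm R -> T) (w : T -> Gm R) : cocharacter v -> character w ->
  forall t, gm_val (w (v t)) = gm_val t ^ pairing v w.
Proof.
move=> [mv vM] [mw wM].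
have ex := @gm_endomorphism R (w \o v) (fmorphism_comp mv mw)
  (fun s t => etrans (congr1 w (vM s t)) (wM _ _)).
exact: (xgetPex 0 ex).
Qed.

Section OneAction.
Variables (Z : fspace R) (a : T -> Z -> Z).
Hypothesis ha : algebraic_action a.

Lemma act_fmorphism s : fmorphism (a s).
Proof.
have [_ _ ma] := ha.
exact: (fmorphism_comp (fmorphism_pair
  (@fmorphism_cst R Z (torus_space T) s) (@fmorphism_id R Z)) ma).
Qed.

Lemma orbit_fmorphism v z : cocharacter v ->
  @fmorphism R (Gm_space R) Z (act_along a v ^~ z).
Proof.
have [_ _ ma] := ha; move=> [mv _].
exact: (fmorphism_comp
  (fmorphism_pair mv (@fmorphism_cst R (Gm_space R) Z z)) ma).
Qed.

Lemma act_alongM v s t z : cocharacter v ->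
  act_along a v (s * t)%g z = act_along a v s (act_along a v t z).
Proof. by move=> [_ vM]; have [_ aM _] := ha; rewrite /act_along vM aM. Qed.

(** Multiplying [t] by [s] does not change the limit at 0. *)
Lemma limit_fixed v z z0 : Defs.separated Z -> cocharacter v ->
  tends_to (act_along a v) z z0 -> fixed_locus (act_along a v) z0.
Proof.
move=> sZ cv zz0 s.
have c1 : econv to0 (fun t => act_along a v (s * t)%g z) z0.
  by move=> A /zz0 zA; exact: (gm_to0_mul s zA).
apply: (separated_econv_unique sZ _ c1).
have -> : (fun t => act_along a v (s * t)%g z) =
    act_along a v s \o (act_along a v ^~ z).
  by apply/funext => t; exact: act_alongM.
by apply: (econv_fmorphism _ zz0); exact: act_fmorphism.
Qed.

End OneAction.

Section Equivariant.
Variables (Y X : fspace R) (aY : T -> Y -> Y) (aX : T -> X -> X) (p : Y -> X).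
Hypotheses (sY : Defs.separated Y) (sX : Defs.separated X).
Hypothesis haY : algebraic_action aY.
Hypothesis p_proj : projective_morphism p.
Hypothesis p_surj : forall x, exists y, p y = x.
Hypothesis p_equiv : forall t y, p (aY t y) = aX t (p y).

Lemma projective_fmorphism : fmorphism p.
Proof.
have [n [i [ci ip]]] := p_proj.
have -> : p = fst \o i by apply/funext => y; rewrite -ip.
exact: (fmorphism_comp (closed_immersion_fmorphism ci) (@fmorphism_fst R _ _)).
Qed.

Lemma tends_to_image v y y0 : tends_to (act_along aY v) y y0 ->
  tends_to (act_along aX v) (p y) (p y0).
Proof.
move=> yy0; suff : econv to0 (act_along aX v ^~ (p y)) (p y0) by [].
have -> : act_along aX v ^~ (p y) = p \o (act_along aY v ^~ y).
  by apply/funext => t; rewrite /= /act_along p_equiv.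
exact: econv_fmorphism projective_fmorphism yy0.
Qed.

(** The valuative criterion of properness for orbits of Gm: the projective
    coordinates of an orbit always have a limit, and the pair of limits lies on
    the closed image of [Y]. *)
Lemma tends_to_lift v y x : cocharacter v ->
  tends_to (act_along aX v) (p y) x ->
  exists y0, tends_to (act_along aY v) y y0.
Proof.
move=> cv px; have [n [i [ci ip]]] := p_proj.
have mi := closed_immersion_fmorphism ci.
have [L hL] := @proj_space_limit R n (snd \o (i \o (act_along aY v ^~ y)))
  (fmorphism_comp (fmorphism_comp (orbit_fmorphism haY y cv) mi)
     (@fmorphism_snd R _ _)).
have [|y0 _ yy0] := @closed_immersion_econv R _ _ i _ to0 _
  (act_along aY v ^~ y) (x, L) ci; last by exists y0.
apply: econv_pair => //.
have -> : fst \o (i \o (act_along aY v ^~ y)) = act_along aX v ^~ (p y).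
  by apply/funext => t; rewrite /= ip /act_along p_equiv.
exact: px.
Qed.

Lemma N_zero_eq : N_zero aY = N_zero aX.
Proof.
apply/seteqP; split=> v [cv comp]; split=> //.
  move=> x; have [y <-] := p_surj x; have [y0 yy0] := comp y.
  by exists (p y0); exact: tends_to_image.
by move=> y; have [x px] := comp (p y); exact: (tends_to_lift cv px).
Qed.

(** A fixed point [x] is the limit of its own orbit, so that the limit of the
    orbit of any point over [x] is a fixed point over [x]. *)
Lemma fixed_locus_image v : cocharacter v -> complete_action (act_along aY v) ->
  p @` fixed_locus (act_along aY v) = fixed_locus (act_along aX v).
Proof.
move=> cv comp; apply/seteqP; split=> [_ [y fy <-] t|x fx].
  by rewrite /act_along -p_equiv; congr p; exact: fy.
have [y yx] := p_surj x; have [y0 yy0] := comp y.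
exists y0; first exact: (limit_fixed haY sY cv yy0).
apply: (separated_econv_unique sX (tends_to_image yy0)).
apply: (@econv_near _ _ _ to0 _ (fun=> x)); last exact: econv_cst.
by apply: (@filterS _ to0 _ _ _ _ filterT) => t _ /=; rewrite yx fx.
Qed.

Lemma N_plus_eq : N_plus aY = N_plus aX.
Proof.
have NE v : N_zero aY v <-> N_zero aX v by rewrite N_zero_eq.
apply/seteqP; split=> v [cv [comp cpt]].
  have [_ compX] := (NE v).1 (conj cv comp); split=> //; split=> //.
  rewrite -(fixed_locus_image cv comp).
  apply: (@continuous_compact (euclidean Y) (euclidean X)) => //.
  apply: continuous_subspaceT.
  exact: fmorphism_continuous projective_fmorphism.
have [_ compY] := (NE v).2 (conj cv comp); split=> //; split=> //.
apply: (projective_compact p_proj cpt).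
  by rewrite (fixed_locus_image cv compY).
move=> G y GU GA Gy s.
apply: (separated_econv_unique sY _ Gy).
apply: (@econv_near _ _ _ G _ (act_along aY v s \o id)).
  by apply: filterS GA => y' fy'; exact: fy'.
by apply: econv_fmorphism Gy; exact: act_fmorphism.
Qed.

End Equivariant.
End Actions.

(** * Coordinates on an affine variety *)

Section Generators.
Variables (R : realType) (X : fspace R) (m : nat) (f : 'I_m -> X -> Cplx R).
Hypotheses (hX : affine_variety X) (gen : generates_coord_ring f).
Local Notation C := (Cplx R).

Lemma meval_cvg (T : Type) (F : set_system T) {FF : Filter F}
    (u : T -> 'I_m -> C) (c : 'I_m -> C) (q : mpoly.mpoly m C) :
  (forall j, u t j @[t --> F] --> c j) ->
  mpoly.meval (u t) q @[t --> F] --> mpoly.meval c q.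
Proof.
move=> uc; have pow j k : u t j ^+ k @[t --> F] --> c j ^+ k.
  rewrite -hornerXn; under eq_cvg do rewrite -hornerXn.
  exact: horner_cvg (uc j).
have mono (e : mpoly.multinom m) :
    \prod_j u t j ^+ e j @[t --> F] --> \prod_j c j ^+ e j.
  exact: (@cvg_big C _ *%R 1 xpredT (@mul_continuous C) T F (index_enum _)
    (fun j t => u t j ^+ e j)).
under eq_cvg do rewrite mpoly.mevalE; rewrite mpoly.mevalE.
have term e : mpoly.mcoeff e q * \prod_j u t j ^+ e j @[t --> F] -->
    mpoly.mcoeff e q * \prod_j c j ^+ e j.
  exact: (cvgM (@cvg_cst C (mpoly.mcoeff e q) T F _) (mono e)).
exact: (@cvg_big C _ +%R 0 xpredT (@add_continuous C) T F (mpoly.msupp q)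
  (fun e t => mpoly.mcoeff e q * \prod_j u t j ^+ e j)).
Qed.

Lemma generators_separate x y : (forall j, f j x = f j y) -> x = y.
Proof.
move=> fxy; have [n [i ci]] := hX; have [inji _ _ _] := ci.
apply: inji; apply/rowP => j.
have [_ r] := closed_immersion_fmorphism ci (so_openT (str (affine_space R n))).
have [q qE] := gen.2 _ (r _ (regular_coordinate j)).
have := qE x; have := qE y; rewrite /= => -> ->.
by apply: mpoly.meval_eq => k; exact: fxy.
Qed.

(** The coordinates of an embedding of [X] are polynomials in the generators, so
    that they converge too, and the image of [X] is closed. *)
Lemma econv_generators (T : Type) (F : set_system T) {FF : ProperFilter F}
    (u : T -> X) (c : 'I_m -> C) :
  (forall j, f j (u t) @[t --> F] --> c j) ->
  exists2 x, econv F u x & forall j, f j x = c j.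
Proof.
move=> fc; have [n [i ci]] := hX.
have [_ r] := closed_immersion_fmorphism ci (so_openT (str (affine_space R n))).
have /all_sig[q qE] (j : 'I_n) : {q : mpoly.mpoly m C |
    forall x, i x ord0 j = mpoly.meval (fun k => f k x) q}.
  by apply: cid; exact: (gen.2 _ (r _ (regular_coordinate j))).
have [|x ix ux] := @closed_immersion_econv R _ _ i _ F _ u
    (\row_j mpoly.meval c (q j)) ci.
  apply: econv_affine => j; rewrite mxE.
  by under eq_cvg do rewrite /= qE; exact: meval_cvg.
exists x => // j; apply: (cvg_unique (@norm_hausdorff _ C) _ (fc j)).
exact: (regular_cvg (gen.1 j) ux).
Qed.

End Generators.

Section Powers.
Variable R : realType.
Local Notation C := (Cplx R).
Local Notation to0 := (@gm_to0 R).

Lemma gm_pow_cvg0 (k : int) : 0 < k ->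
  (fun t => gm_val t ^ k) @ to0 --> (0 : C).
Proof.
case: k => // -[//|k] _; have := @horner_cvg0 R 'X^(k.+1).
rewrite hornerXn expr0n /=; apply: cvg_trans; apply: near_eq_cvg.
by apply: (@filterS _ to0 _ _ _ _ filterT) => t _; rewrite hornerXn.
Qed.

Lemma gm_powM_cvg0 (k : int) (z : C) : 0 < k ->
  (fun t => gm_val t ^ k * z) @ to0 --> (0 : C).
Proof.
move=> k0; rewrite -[X in _ --> X](mul0r z).
exact: (cvgM (gm_pow_cvg0 k0) (@cvg_cst C z _ to0 _)).
Qed.

(** If [k < 0], the factor [t ^ (- k)] tends to 0 and turns [t ^ k * z] into the
    constant [z]. *)
Lemma gm_pow_cvg_ge0 (k : int) (z l : C) : z != 0 ->
  (fun t => gm_val t ^ k * z) @ to0 --> l -> 0 <= k.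
Proof.
move=> z0 kl; rewrite leNgt; apply/negP => k0.
have nk0 : 0 < - k by rewrite oppr_gt0.
have l0 : (fun t => gm_val t ^ (- k) * (gm_val t ^ k * z)) @ to0 --> (0 : C).
  by rewrite -[X in _ --> X](mul0r l); exact: (cvgM (gm_pow_cvg0 nk0) kl).
have zl : (fun=> z) @ to0 --> (0 : C).
  apply: cvg_trans l0; apply: near_eq_cvg.
  apply: (@filterS _ to0 _ _ _ _ filterT) => t _ /=.
  by rewrite mulrA -expfzDr ?gm_val_neq0 // addNr expr0z mul1r.
have z0' : z = 0.
  exact: (cvg_unique (@norm_hausdorff _ C) (@cvg_cst C z _ to0 _) zl).
by rewrite z0' eqxx in z0.
Qed.

End Powers.

(** * Weights of the generators *)

Section Weights.
Variables (R : realType) (d : nat) (T : torus R d) (X : fspace R).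
Variable aX : T -> X -> X.
Hypotheses (hX : affine_variety X) (haX : algebraic_action aX).
Variables (m : nat) (w : 'I_m -> T -> Gm R) (f : 'I_m -> X -> Cplx R).
Hypotheses (cw : forall j, character (w j)).
Hypothesis fw : forall j, weight_space aX (w j) (f j).
Hypothesis f_nonconstant : forall j, ~ constant_functions (f j).
Hypothesis gen : generates_coord_ring f.
Variable v : Gm R -> T.
Hypothesis cv : cocharacter v.
Local Notation C := (Cplx R).
Local Notation to0 := (@gm_to0 R).
Local Notation k j := (pairing v (w j)).
Local Notation phi := (act_along aX v).

Lemma act_along_weight j t x : f j (phi t x) = gm_val t ^ k j * f j x.
Proof. by rewrite /act_along (fw j).2 (pairingE cv (cw j)). Qed.

Let hausC := @norm_hausdorff _ C.

Lemma generator_limit0 j x x0 : 0 < k j -> tends_to phi x x0 -> f j x0 = 0.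
Proof.
move=> kj xx0.
have f0 : f j (phi t x) @[t --> to0] --> (0 : C).
  under eq_cvg do rewrite act_along_weight.
  exact: gm_powM_cvg0.
exact: (cvg_unique hausC (regular_cvg (gen.1 j) xx0) f0).
Qed.

Lemma generator_limit j x x0 : k j = 0 -> tends_to phi x x0 -> f j x0 = f j x.
Proof.
move=> kj xx0; have fx : f j (phi t x) @[t --> to0] --> f j x.
  under eq_cvg do rewrite act_along_weight kj expr0z mul1r.
  exact: cvg_cst.
exact: (cvg_unique hausC (regular_cvg (gen.1 j) xx0) fx).
Qed.

Lemma fixed_tends_to x : fixed_locus phi x -> tends_to phi x x.
Proof.
move=> fx; apply: (@econv_near _ _ _ to0 _ (fun=> x)); last exact: econv_cst.
by apply: (@filterS _ to0 _ _ _ _ filterT) => t _ /=; rewrite fx.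
Qed.

(** The limit of [t ^ k * z] as [t] tends to 0 exists when [k >= 0], and only
    then unless [z = 0]; on [X], limits exist as soon as they exist for all the
    generators, because the image of [X] in affine space is closed. *)
Lemma complete_weights : complete_action phi <-> forall j, 0 <= k j.
Proof.
split=> [comp j|k0 x].
  have [x fx] : exists x, f j x != 0.
    apply: contrapT => /forallNP f0; apply: (f_nonconstant (j := j)).
    by exists 0 => x; apply/eqP/negPn/negP/f0.
  have [x0 xx0] := comp x.
  apply: (gm_pow_cvg_ge0 fx (l := f j x0)).
  under eq_cvg do rewrite -act_along_weight.
  exact: (regular_cvg (gen.1 j) xx0).
have fc j : f j (phi t x) @[t --> to0] --> if k j == 0 then f j x else 0.
  under eq_cvg do rewrite act_along_weight.
  have [kj|kj] := eqVneq (k j) 0.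
    have -> : (fun t => gm_val t ^ k j * f j x) = (fun=> f j x).
      by apply/funext => t; rewrite kj expr0z mul1r.
    exact: cvg_cst.
  by apply: gm_powM_cvg0; rewrite lt_neqAle eq_sym kj k0.
by have [x0 xx0 _] := econv_generators hX gen fc; exists x0.
Qed.

Lemma generators_zero_unique x y :
  (forall j, f j x = 0) -> (forall j, f j y = 0) -> x = y.
Proof.
by move=> x0 y0; apply: (generators_separate hX gen) => j; rewrite x0 y0.
Qed.

(** A generator of weight 0 takes the same value at [x] and at the limit of the
    orbit of [x], which lies in the fixed locus.  If the latter is compact, that
    generator is therefore bounded on [X], hence constant.  Conversely,
    generators of positive weight vanish on the fixed locus, which then has at
    most one point. *)
Lemma contracting_weights : connected [set: euclidean X] ->
  contracting_action phi <-> forall j, 0 < k j.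
Proof.
move=> conn; split=> [[comp cpt] j|k0].
  have := complete_weights.1 comp j; rewrite le_eqVlt => /orP[/eqP kj|//].
  exfalso; apply: (f_nonconstant (j := j)).
  have lim x : exists2 x0, fixed_locus phi x0 & f j x0 = f j x.
    have [x0 xx0] := comp x; exists x0.
      exact: (limit_fixed haX (affine_variety_separated hX) cv xx0).
    exact: (generator_limit (esym kj) xx0).
  have [[x _]|/forallNP nX] := pselect (exists x : X, True); last first.
    by exists 0 => x; case: (nX x).
  have [x0 fx0 _] := lim x.
  have cf : continuous (fun x : euclidean X => complex.Re (f j x)).
    move=> z; apply: continuous_comp; last exact: continuous_Re.
    exact: (@regular_cvg _ _ _ (nbhs (z : euclidean X)) _ (f j) id z (gen.1 j)
      (@cvg_id _ _)).
  have [|b _ bmax] := @compact_EVT_max (euclidean X) R _ _ _ cpt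
    (continuous_subspaceT cf); first by exists x0.
  have [|P P0 Pf] :=
      bounded_regular_root (B := complex.Re (f j b)) gen (gen.1 j).
    move=> y; have [y0 fy0 <-] := lim y; apply: bmax; exact/mem_set.
  exact: (connected_root_constant conn (gen.1 j) P0 Pf).
split; first by apply/complete_weights => j; exact: ltW.
have fix0 x : fixed_locus phi x -> forall j, f j x = 0.
  by move=> fx j; exact: (generator_limit0 (k0 j) (fixed_tends_to fx)).
have [[x fx]|/forallNP nfix] := pselect (exists x, fixed_locus phi x).
  have -> : fixed_locus phi = [set x : euclidean X].
    apply/seteqP; split=> [y fy|_ ->//].
    by apply: generators_zero_unique; exact: fix0.
  exact: compact_set1.
have -> : fixed_locus phi = (set0 : set (euclidean X)).
  by apply/seteqP; split=> // x /nfix.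
exact: compact0.
Qed.

(** All orbits tend to [x0], and invariant functions are constant on orbits. *)
Lemma contracting_invariants (x0 : X) (g : X -> C) : (forall j, 0 < k j) ->
  (forall j, f j x0 = 0) -> weight_space aX (@trivial_character R d T) g ->
  constant_functions g.
Proof.
move=> k0 fx0 [rg gw]; exists (g x0) => x.
have [x1 xx1] := complete_weights.2 (fun j => ltW (k0 j)) x.
have -> : x0 = x1.
  by apply: generators_zero_unique => // j;
    exact: (generator_limit0 (k0 j) xx1).
have gx : g (phi t x) @[t --> to0] --> g x.
  under eq_cvg do rewrite /act_along gw /gm_val /= mul1r.
  exact: cvg_cst.
exact: (cvg_unique hausC gx (regular_cvg rg xx1)).
Qed.

End Weights.

Theorem lemma1p20 (R : realType) (d : nat) (T : torus R d) (Y X : fspace R)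
    (aY : T -> Y -> Y) (aX : T -> X -> X) (p : Y -> X)
    (hY : variety Y)
    (Y_connected : connected [set: euclidean Y])
    (Y_noncompact : ~ compact [set: euclidean Y])
    (Y_nonsingular : nonsingular Y)
    (hX : affine_variety X)
    (haY : algebraic_action aY) (haX : algebraic_action aX)
    (p_proj : projective_morphism p)
    (p_surj : forall x, exists y, p y = x)
    (p_equiv : forall t y, p (aY t y) = aX t (p y)) :
  [/\ N_plus aY = N_plus aX,
      N_zero aY = N_zero aX &
      forall (m : nat) (w : 'I_m -> T -> Gm R) (f : 'I_m -> X -> Cplx R),
        (forall j, character (w j)) ->
        (forall j, weight_space aX (w j) (f j)) ->
        (forall j, ~ constant_functions (f j)) ->
        generates_coord_ring f ->
        [/\ N_zero aX =
              [set v | cocharacter v /\ forall j, 0 <= pairing v (w j)],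
            N_plus aX =
              [set v | cocharacter v /\ forall j, 0 < pairing v (w j)] &
            N_plus aX !=set0 ->
            [/\ weight_space aX (@trivial_character R d T) =
                  @constant_functions R X,
                forall j, w j <> @trivial_character R d T &
                exists2 x0, torus_fixed aX = [set x0] &
                  forall v, N_plus aX v -> contracts_to (act_along aX v) x0]]].
Proof.
have sY := hY.1; have sX := affine_variety_separated hX.
split; first exact: (N_plus_eq sY sX haY p_proj p_surj p_equiv).
  exact: (N_zero_eq haY p_proj p_surj p_equiv).
move=> m w f cw fw fnc gen.
have X_connected : connected [set: euclidean X].
  have <- : p @` [set: euclidean Y] = [set: euclidean X].
    by apply/seteqP; split=> // x _; have [y <-] := p_surj x; exists y.
  apply: (@connected_continuous_connected (euclidean Y) (euclidean X)) => //.
  apply: continuous_subspaceT.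
  exact: fmorphism_continuous (projective_fmorphism p_proj).
have N0 v (cv : cocharacter v) := complete_weights hX cw fw fnc gen cv.
have Np v (cv : cocharacter v) :=
  contracting_weights hX haX cw fw fnc gen cv X_connected.
split.
- by apply/seteqP; split=> v [cv] /(N0 v cv).
- by apply/seteqP; split=> v [cv] /(Np v cv).
move=> [v [cv /(Np v cv) k0]].
(* The empty set is compact, so that [Y] and [X] have a point. *)
have [x1 _] : exists x1 : X, True.
  apply: contrapT => /forallNP nX; apply: Y_noncompact.
  rewrite (_ : setT = set0); first exact: compact0.
  by apply/seteqP; split=> // y _; case: (nX (p y)).
have [x0 xx0] := (N0 v cv).2 (fun j => ltW (k0 j)) x1.
have fx0 j : f j x0 = 0 := generator_limit0 cw fw gen cv (k0 j) xx0.
have eq_x0 u x : cocharacter u -> (forall j, 0 < pairing u (w j)) ->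
    (exists x', tends_to (act_along aX u) x' x) -> x = x0.
  move=> cu l0 [x' xx']; apply: (generators_zero_unique hX gen) => // j.
  exact: (generator_limit0 cw fw gen cu (l0 j) xx').
have eq_fix x : fixed_locus (act_along aX v) x -> x = x0.
  by move=> fx; apply: (eq_x0 v) => //; exists x; exact: fixed_tends_to.
have inv0 g : weight_space aX (@trivial_character R d T) g ->
    constant_functions g.
  exact: (contracting_invariants hX cw fw fnc gen cv k0 fx0).
split.
- apply/seteqP; split=> g; first exact: inv0.
  move=> [c gc]; have -> : g = (fun=> c) by apply/funext.
  split=> [|t z]; first by apply: so_regular_cst; exact: so_openT.
  by rewrite /trivial_character /gm_val /= mul1r.
- by move=> j wj; apply: (fnc j); apply: inv0; rewrite -wj.
- exists x0.
    apply/seteqP; split=> [x fx|_ -> s]; first by apply: eq_fix => t; exact: fx.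
    have fix0 := limit_fixed haX sX cv xx0.
    have [_ aM _] := haX; apply: eq_fix => t.
    by rewrite /act_along -aM torus_mulC aM; congr aX; exact: fix0.
  move=> u [cu /(Np u cu) l0] x.
  have [x' xx'] := (N0 u cu).2 (fun j => ltW (l0 j)) x.
  by rewrite -(eq_x0 u x' cu l0) //; exists x.
Qed.
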